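(* Let $\mathcal{C}$ be a fusion category over $\mathbb{C}$ with integer Frobenius–Perron dimensions, and let $\mathcal{M}$ be an indecomposable module category over $\mathcal{C}$. Then the fusion category $\mathcal{C}^*_{\mathcal{M}}$ has integer Frobenius–Perron dimensions.
   Context: A fusion category over $\mathbb{C}$ is a $\mathbb{C}$-linear semisimple rigid tensor category with finitely many isomorphism classes of simple objects, finite dimensional Hom spaces, and $\operatorname{End}(\mathbf 1)=\mathbb{C}$. For an object $X$, the Frobenius–Perron dimension $\mathrm{FPdim}(X)$ is the largest positive eigenvalue of the matrix of multiplication by $X$ in the Grothendieck ring with respect to the basis of simple objects. A fusion category has integer Frobenius–Perron dimensions if $\mathrm{FPdim}(X)\in\mathbb{Z}$ for every object $X$. A (left) module category over $\mathcal{C}$ is a $\mathbb{C}$-linear semisimple category $\mathcal{M}$ with finitely many simple objects and finite dimensional Hom spaces, with a bilinear action bifunctor $\mathcal{C}\times\mathcal{M}\to\mathcal{M}$ and associativity and unit isomorphisms satisfying the usual axioms; it is indecomposable if it is nonzero and not a direct sum of two nonzero module subcategories. $\mathcal{C}^*_{\mathcal{M}}=\mathrm{Fun}_{\mathcal{C}}(\mathcal{M},\mathcal{M})$ is the category of $\mathcal{C}$-module functors $\mathcal{M}\to\mathcal{M}$, with tensor product given by composition; it is a fusion category. *)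

(* Defs.v *)
From HB Require Import structures.
From mathcomp Require Import all_boot all_order all_algebra.
From mathcomp Require Export complex.
From mathcomp Require Import boolp.
From mathcomp Require Export reals.

Set Implicit Arguments.
Unset Strict Implicit.
Unset Printing Implicit Defensive.

Import Order.TTheory GRing.Theory Num.Theory.
Local Open Scope ring_scope.

Declare Scope cat_scope.
Delimit Scope cat_scope with cat.
Open Scope cat_scope.

Reserved Notation "g \oc f" (at level 50, left associativity).
Reserved Notation "X \ox Y" (at level 40, left associativity).
Reserved Notation "f \oxm g" (at level 40, left associativity).
Reserved Notation "X \act M" (at level 40, left associativity).
Reserved Notation "f \actm g" (at level 40, left associativity).

Record linCat (K : fieldType) := LinCat {
  obj :> Type;
  hom : obj -> obj -> lmodType K;
  idm : forall X, hom X X;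
  comp : forall X Y Z, hom Y Z -> hom X Y -> hom X Z;
  comp_idl : forall X Y (f : hom X Y), comp (idm Y) f = f;
  comp_idr : forall X Y (f : hom X Y), comp f (idm X) = f;
  compA : forall W X Y Z (h : hom Y Z) (g : hom X Y) (f : hom W X),
    comp h (comp g f) = comp (comp h g) f;
  comp_linl : forall X Y Z (f : hom X Y), linear (fun g : hom Y Z => comp g f);
  comp_linr : forall X Y Z (g : hom Y Z), linear (fun f : hom X Y => comp g f)
}.

Arguments hom {K C} : rename.
Arguments idm {K C} : rename.
Arguments comp {K C X Y Z} : rename.

Notation "g \oc f" := (comp g f) : cat_scope.

Section CategoryTheory.
Variables (K : fieldType) (C : linCat K).
Implicit Types X Y Z W : C.

Definition is_inv X Y (f : hom X Y) (g : hom Y X) : Prop :=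
  g \oc f = idm X /\ f \oc g = idm Y.

Definition is_iso X Y (f : hom X Y) : Prop := exists g, is_inv f g.

Definition iso X Y : Prop := exists f : hom X Y, is_iso f.

Definition is_zero X : Prop := idm X = 0.

Definition is_mono X Y (f : hom X Y) : Prop :=
  forall W (u v : hom W X), f \oc u = f \oc v -> u = v.

Definition is_epi X Y (f : hom X Y) : Prop :=
  forall W (u v : hom Y W), u \oc f = v \oc f -> u = v.

Definition is_kernel X Y (f : hom X Y) Z (k : hom Z X) : Prop :=
  f \oc k = 0 /\
  forall W (u : hom W X), f \oc u = 0 -> exists! v : hom W Z, k \oc v = u.

Definition is_cokernel X Y (f : hom X Y) Z (q : hom Y Z) : Prop :=
  q \oc f = 0 /\
  forall W (u : hom Y W), u \oc f = 0 -> exists! v : hom Z W, v \oc q = u.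

(* X is a direct sum (biproduct) of the finite family F; an empty family      *)
(* gives a zero object.                                                       *)
Definition is_dsum (I : finType) (F : I -> C) X : Prop :=
  exists (inj : forall i, hom (F i) X) (prj : forall i, hom X (F i)),
    [/\ forall i, prj i \oc inj i = idm (F i),
        forall i j, i != j -> prj j \oc inj i = 0
      & \sum_i (inj i \oc prj i) = idm X].

Definition is_dsum2 (A B X : C) : Prop :=
  is_dsum (fun b : bool => if b then A else B) X.

Definition additive_cat : Prop :=
  forall (I : finType) (F : I -> C), exists X, is_dsum F X.

Definition abelian_cat : Prop :=
  [/\ additive_cat,
      forall X Y (f : hom X Y), exists Z (k : hom Z X), is_kernel f k,
      forall X Y (f : hom X Y), exists Z (q : hom Y Z), is_cokernel f q,
      forall X Y (f : hom X Y),
        is_mono f -> exists Z (g : hom Y Z), is_kernel g f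
    & forall X Y (f : hom X Y),
        is_epi f -> exists Z (g : hom Z X), is_cokernel g f].

Definition simple_obj X : Prop :=
  ~ is_zero X /\
  forall Y (f : hom Y X), is_mono f -> is_zero Y \/ is_iso f.

Definition semisimple_cat : Prop :=
  abelian_cat /\
  forall X, exists (I : finType) (S : I -> C),
    (forall i, simple_obj (S i)) /\ is_dsum S X.

Definition simple_basis n (S : 'I_n -> C) : Prop :=
  [/\ forall i, simple_obj (S i),
      forall i j, iso (S i) (S j) -> i = j
    & forall X, simple_obj X -> exists i, iso X (S i)].

Definition finite_dim (V : lmodType K) : Prop :=
  exists n (e : 'I_n -> V), forall v, exists c : 'I_n -> K,
    v = \sum_i c i *: e i.

Definition finite_semisimple_cat : Prop :=
  [/\ semisimple_cat,
      exists n (S : 'I_n -> C), simple_basis S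
    & forall X Y, finite_dim (hom X Y)].

End CategoryTheory.

Record tensorCat (K : fieldType) := TensorCat {
  tcat :> linCat K;
  tunit : tcat;
  tobj : tcat -> tcat -> tcat;
  tmor : forall X X' Y Y' : tcat,
    hom X X' -> hom Y Y' -> hom (tobj X Y) (tobj X' Y');
  assoc : forall X Y Z, hom (tobj (tobj X Y) Z) (tobj X (tobj Y Z));
  assocV : forall X Y Z, hom (tobj X (tobj Y Z)) (tobj (tobj X Y) Z);
  lunit : forall X, hom (tobj tunit X) X;
  runit : forall X, hom (tobj X tunit) X;
  tmor_linl : forall (X X' Y Y' : tcat) (g : hom Y Y'),
    linear (fun f : hom X X' => tmor f g);
  tmor_linr : forall (X X' Y Y' : tcat) (f : hom X X'),
    linear (fun g : hom Y Y' => tmor f g);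
  tmor_id : forall X Y, tmor (idm X) (idm Y) = idm (tobj X Y);
  tmor_comp : forall (X X' X'' Y Y' Y'' : tcat)
      (f' : hom X' X'') (f : hom X X') (g' : hom Y' Y'') (g : hom Y Y'),
    tmor (f' \oc f) (g' \oc g) = tmor f' g' \oc tmor f g;
  assocK : forall X Y Z, is_inv (assoc X Y Z) (assocV X Y Z);
  lunit_iso : forall X, is_iso (lunit X);
  runit_iso : forall X, is_iso (runit X);
  assoc_nat : forall (X X' Y Y' Z Z' : tcat)
      (f : hom X X') (g : hom Y Y') (h : hom Z Z'),
    assoc X' Y' Z' \oc tmor (tmor f g) h = tmor f (tmor g h) \oc assoc X Y Z;
  lunit_nat : forall (X X' : tcat) (f : hom X X'),
    lunit X' \oc tmor (idm tunit) f = f \oc lunit X;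
  runit_nat : forall (X X' : tcat) (f : hom X X'),
    runit X' \oc tmor f (idm tunit) = f \oc runit X;
  pentagon : forall W X Y Z,
    assoc W X (tobj Y Z) \oc assoc (tobj W X) Y Z =
    tmor (idm W) (assoc X Y Z) \oc assoc W (tobj X Y) Z
      \oc tmor (assoc W X Y) (idm Z);
  triangle : forall X Y,
    tmor (idm X) (lunit Y) \oc assoc X tunit Y = tmor (runit X) (idm Y)
}.

Arguments tunit {K} C : rename.
Arguments tobj {K C} : rename.
Arguments tmor {K C X X' Y Y'} : rename.
Arguments assoc {K C} : rename.
Arguments assocV {K C} : rename.
Arguments lunit {K C} : rename.
Arguments runit {K C} : rename.

Notation "X \ox Y" := (tobj X Y) : cat_scope.
Notation "f \oxm g" := (tmor f g) : cat_scope.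

(* D is a left dual of X, equivalently X is a right dual of D.                *)
(* The two equations are the zigzag identities, precomposed with the unitors. *)
Definition is_dual (K : fieldType) (C : tensorCat K) (D X : C) : Prop :=
  exists (ev : hom (D \ox X) (tunit C)) (coev : hom (tunit C) (X \ox D)),
    runit X \oc (idm X \oxm ev) \oc assoc X D X \oc (coev \oxm idm X) = lunit X
    /\
    lunit D \oc (ev \oxm idm D) \oc assocV D X D \oc (idm D \oxm coev) = runit D.

Definition rigid_cat (K : fieldType) (C : tensorCat K) : Prop :=
  forall X : C, (exists D, is_dual D X) /\ (exists D, is_dual X D).

(* K -> End(1), c |-> c id is bijective: End(1) = K.                         *)
Definition is_fusion (K : fieldType) (C : tensorCat K) : Prop :=
  [/\ finite_semisimple_cat C,
      rigid_cat C
    & bijective (fun c : K => c *: idm (tunit C))].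

(* Row i of N holds the coordinates of [X][S i] in the basis of the simple    *)
(* classes [S j]: X (x) S i is a direct sum of N i j copies of each S j.      *)
Definition mult_matrix (K : fieldType) (C : tensorCat K) (X : C)
    n (S : 'I_n -> C) (N : 'M[nat]_n) : Prop :=
  forall i, is_dsum (fun k : {j : 'I_n & 'I_(N i j)} => S (tag k)) (X \ox S i).

Definition largest_pos_eigenvalue (R : realType) n (A : 'M[R]_n) (d : R) : Prop :=
  [/\ eigenvalue A d, 0 < d & forall a, eigenvalue A a -> 0 < a -> a <= d].

(* The Frobenius-Perron dimension of a zero object, whose matrix has no       *)
(* positive eigenvalue, is 0.                                                 *)
Definition is_FPdim (R : realType) (C : tensorCat R[i]) (X : C) (d : R) : Prop :=
  (is_zero X /\ d = 0) \/
  exists n (S : 'I_n -> C) (N : 'M[nat]_n),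
    [/\ simple_basis S, mult_matrix X S N
      & largest_pos_eigenvalue (map_mx (fun m : nat => m%:R) N) d].

Definition integer_FPdims (R : realType) (C : tensorCat R[i]) : Prop :=
  forall X : C, exists z : int, is_FPdim X z%:~R.

Record moduleCat (K : fieldType) (C : tensorCat K) := ModuleCat {
  mcat :> linCat K;
  act : C -> mcat -> mcat;
  actm : forall (X Y : C) (M N : mcat),
    hom X Y -> hom M N -> hom (act X M) (act Y N);
  massoc : forall X Y M, hom (act (X \ox Y) M) (act X (act Y M));
  munit : forall M, hom (act (tunit C) M) M;
  actm_linl : forall (X Y : C) (M N : mcat) (g : hom M N),
    linear (fun f : hom X Y => actm f g);
  actm_linr : forall (X Y : C) (M N : mcat) (f : hom X Y),
    linear (fun g : hom M N => actm f g);
  actm_id : forall X M, actm (idm X) (idm M) = idm (act X M);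
  actm_comp : forall (X X' X'' : C) (M M' M'' : mcat)
      (f' : hom X' X'') (f : hom X X') (g' : hom M' M'') (g : hom M M'),
    actm (f' \oc f) (g' \oc g) = actm f' g' \oc actm f g;
  massoc_iso : forall X Y M, is_iso (massoc X Y M);
  munit_iso : forall M, is_iso (munit M);
  massoc_nat : forall (X X' Y Y' : C) (M M' : mcat)
      (f : hom X X') (g : hom Y Y') (h : hom M M'),
    massoc X' Y' M' \oc actm (f \oxm g) h =
    actm f (actm g h) \oc massoc X Y M;
  munit_nat : forall (M M' : mcat) (h : hom M M'),
    munit M' \oc actm (idm (tunit C)) h = h \oc munit M;
  mpentagon : forall X Y Z M,
    massoc X Y (act Z M) \oc massoc (X \ox Y) Z M =
    actm (idm X) (massoc Y Z M) \oc massoc X (Y \ox Z) M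
      \oc actm (assoc X Y Z) (idm M);
  mtriangle : forall X M,
    actm (idm X) (munit M) \oc massoc X (tunit C) M =
    actm (runit X) (idm M)
}.

Arguments act {K C M} : rename.
Arguments actm {K C M X Y M1 M2} : rename.
Arguments massoc {K C M} : rename.
Arguments munit {K C M} : rename.

Notation "X \act M" := (act X M) : cat_scope.
Notation "f \actm g" := (actm f g) : cat_scope.

Section Indecomposable.
Variables (K : fieldType) (C : tensorCat K) (M : moduleCat C).

(* A module subcategory is a full, replete subcategory closed under finite    *)
(* direct sums, direct summands and the action, given by its objects.         *)
Definition module_subcat (P : M -> Prop) : Prop :=
  [/\ forall A B : M, iso A B -> P A -> P B,
      forall (I : finType) (F : I -> M) A,
        is_dsum F A -> (forall i, P (F i)) -> P A,
      forall (I : finType) (F : I -> M) A,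
        is_dsum F A -> P A -> forall i, P (F i)
    & forall (X : C) A, P A -> P (X \act A)].

Definition nonzero_subcat (P : M -> Prop) : Prop :=
  exists A, P A /\ ~ is_zero A.

Definition subcat_dsum (P Q : M -> Prop) : Prop :=
  (forall A B : M, P A -> Q B ->
     (forall f : hom A B, f = 0) /\ (forall f : hom B A, f = 0)) /\
  (forall X : M, exists A B, [/\ P A, Q B & is_dsum2 A B X]).

Definition indecomposable : Prop :=
  (exists A : M, ~ is_zero A) /\
  ~ exists P Q : M -> Prop,
      [/\ module_subcat P, module_subcat Q, nonzero_subcat P, nonzero_subcat Q
        & subcat_dsum P Q].

End Indecomposable.

(* C-module endofunctors of M.                                                *)
Record modFunctor (K : fieldType) (C : tensorCat K) (M : moduleCat C) :=
  ModFunctor {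
  fob :> M -> M;
  fmap : forall A B : M, hom A B -> hom (fob A) (fob B);
  fstr : forall (X : C) (A : M), hom (fob (X \act A)) (X \act fob A);
  fmap_lin : forall A B : M, linear (@fmap A B);
  fmap_id : forall A : M, fmap (idm A) = idm (fob A);
  fmap_comp : forall (A B D : M) (g : hom B D) (f : hom A B),
    fmap (g \oc f) = fmap g \oc fmap f;
  fstr_iso : forall X A, is_iso (fstr X A);
  fstr_nat : forall (X X' : C) (A A' : M) (f : hom X X') (g : hom A A'),
    fstr X' A' \oc fmap (f \actm g) = (f \actm fmap g) \oc fstr X A;
  fstr_assoc : forall (X Y : C) (A : M),
    (idm X \actm fstr Y A) \oc fstr X (Y \act A) \oc fmap (massoc X Y A) =
    massoc X Y (fob A) \oc fstr (X \ox Y) A;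
  fstr_unit : forall A : M,
    munit (fob A) \oc fstr (tunit C) A = fmap (munit A)
}.

Arguments fmap {K C M} F {A B} : rename.
Arguments fstr {K C M} F : rename.

Record modTrans (K : fieldType) (C : tensorCat K) (M : moduleCat C)
    (F G : modFunctor M) := ModTrans {
  tr :> forall A : M, hom (F A) (G A);
  tr_nat : forall (A B : M) (f : hom A B), tr B \oc fmap F f = fmap G f \oc tr A;
  tr_str : forall (X : C) (A : M),
    fstr G X A \oc tr (X \act A) = (idm X \actm tr A) \oc fstr F X A
}.

Section LinearLemmas.
Variables (K : fieldType) (U V : lmodType K) (f : U -> V).
Hypothesis f_lin : linear f.

Let g := HB.pack_for {linear U -> V} f
  (GRing.isLinear.Build K U V *:%R f f_lin).

Lemma lin0 : f 0 = 0. Proof. exact: (raddf0 g). Qed.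
Lemma linD u v : f (u + v) = f u + f v. Proof. exact: (raddfD g). Qed.
Lemma linN u : f (- u) = - f u. Proof. exact: (raddfN g). Qed.
Lemma linZ a u : f (a *: u) = a *: f u. Proof. exact: (linearZ_LR g). Qed.
End LinearLemmas.

Section ModTransLmod.
Variables (K : fieldType) (C : tensorCat K) (M : moduleCat C).
Variables (F G : modFunctor M).

Lemma modTransP (s t : modTrans F G) : (forall A, s A = t A) -> s = t.
Proof.
case: s t => [s s1 s2] [t t1 t2] /= est.
have e : s = t by exact: functional_extensionality_dep.
move: s1 s2 t1 t2; rewrite e => s1 s2 t1 t2.
by congr ModTrans; exact: Prop_irrelevance.
Qed.

Definition trD_def (s t : modTrans F G) : modTrans F G.
Proof.
exists (fun A => s A + t A).
- move=> A B f; rewrite (linD (comp_linl _)) (linD (comp_linr _)).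
  by rewrite !tr_nat.
- move=> X A; rewrite (linD (comp_linr _)) (linD (actm_linr _)).
  by rewrite (linD (comp_linl _)) !tr_str.
Defined.

Definition tr0_def : modTrans F G.
Proof.
exists (fun A => 0).
- by move=> A B f; rewrite (lin0 (comp_linl _)) (lin0 (comp_linr _)).
- move=> X A; rewrite (lin0 (comp_linr _)) (lin0 (actm_linr _)).
  by rewrite (lin0 (comp_linl _)).
Defined.

Definition trN_def (s : modTrans F G) : modTrans F G.
Proof.
exists (fun A => - s A).
- by move=> A B f; rewrite (linN (comp_linl _)) (linN (comp_linr _)) tr_nat.
- move=> X A; rewrite (linN (comp_linr _)) (linN (actm_linr _)).
  by rewrite (linN (comp_linl _)) tr_str.
Defined.

Definition trZ_def (a : K) (s : modTrans F G) : modTrans F G.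
Proof.
exists (fun A => a *: s A).
- by move=> A B f; rewrite (linZ (comp_linl _)) (linZ (comp_linr _)) tr_nat.
- move=> X A; rewrite (linZ (comp_linr _)) (linZ (actm_linr _)).
  by rewrite (linZ (comp_linl _)) tr_str.
Defined.

HB.instance Definition _ := gen_eqMixin (modTrans F G).
HB.instance Definition _ := gen_choiceMixin (modTrans F G).

Lemma trDA : associative trD_def.
Proof. by move=> r s t; apply: modTransP => A; exact: addrA. Qed.
Lemma trDC : commutative trD_def.
Proof. by move=> s t; apply: modTransP => A; exact: addrC. Qed.
Lemma tr0D : left_id tr0_def trD_def.
Proof. by move=> s; apply: modTransP => A; exact: add0r. Qed.
Lemma trND : left_inverse tr0_def trN_def trD_def.
Proof. by move=> s; apply: modTransP => A; exact: addNr. Qed.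

HB.instance Definition _ :=
  GRing.isZmodule.Build (modTrans F G) trDA trDC tr0D trND.

Lemma trZA a b (s : modTrans F G) :
  trZ_def a (trZ_def b s) = trZ_def (a * b) s.
Proof. by apply: modTransP => A; exact: scalerA. Qed.
Lemma tr1Z : left_id 1 trZ_def.
Proof. by move=> s; apply: modTransP => A; exact: scale1r. Qed.
Lemma trZDr : right_distributive trZ_def +%R.
Proof. by move=> a s t; apply: modTransP => A; exact: scalerDr. Qed.
Lemma trZDl (s : modTrans F G) : {morph trZ_def^~ s : a b / a + b}.
Proof. by move=> a b; apply: modTransP => A; exact: scalerDl. Qed.

HB.instance Definition _ :=
  GRing.Zmodule_isLmodule.Build K (modTrans F G) trZA tr1Z trZDr trZDl.

End ModTransLmod.

Section IsoLemmas.
Variables (K : fieldType) (C : linCat K).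

Lemma is_inv_id (X : C) : is_inv (idm X) (idm X).
Proof. by split; exact: comp_idl. Qed.

Lemma is_iso_id (X : C) : is_iso (idm X).
Proof. by exists (idm X); exact: is_inv_id. Qed.

Lemma is_iso_comp (X Y Z : C) (g : hom Y Z) (f : hom X Y) :
  is_iso g -> is_iso f -> is_iso (g \oc f).
Proof.
case=> g' [g'g gg'] [f' [f'f ff']]; exists (f' \oc g'); split.
- by rewrite compA -(compA f') g'g comp_idr f'f.
- by rewrite compA -(compA g) ff' comp_idr gg'.
Qed.
End IsoLemmas.

Section Dual.
Variables (K : fieldType) (C : tensorCat K) (M : moduleCat C).
Implicit Types F G H : modFunctor M.

Lemma fmap_iso F (A B : M) (f : hom A B) : is_iso f -> is_iso (fmap F f).
Proof.
by case=> g [gf fg]; exists (fmap F g); split;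
  rewrite -fmap_comp ?gf ?fg fmap_id.
Qed.

Lemma actm_idD (X : C) (A B D : M) (g : hom B D) (f : hom A B) :
  idm X \actm (g \oc f) = (idm X \actm g) \oc (idm X \actm f).
Proof. by rewrite -actm_comp comp_idl. Qed.

Definition idF : modFunctor M.
Proof.
exists (fun A => A) (fun A B f => f) (fun X A => idm (X \act A)).
- by move=> A B a f g.
- by [].
- by [].
- by move=> X A; exact: is_iso_id.
- by move=> X X' A A' f g; rewrite comp_idl comp_idr.
- by move=> X Y A; rewrite actm_id !comp_idl comp_idr.
- by move=> A; rewrite comp_idr.
Defined.

(* F after G, with F(G(X A)) -> F(X G(A)) -> X F(G(A)) as structure map.      *)
Definition compF F G : modFunctor M.
Proof.
exists (fun A => F (G A)) (fun A B f => fmap F (fmap G f))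
  (fun X A => fstr F X (G A) \oc fmap F (fstr G X A)).
- by move=> A B a f g; rewrite (fmap_lin G) (fmap_lin F).
- by move=> A; rewrite !fmap_id.
- by move=> A B D g f; rewrite !fmap_comp.
- move=> X A; apply: is_iso_comp; first exact: fstr_iso.
  by apply: fmap_iso; exact: fstr_iso.
- move=> X X' A A' f g.
  by rewrite -compA -fmap_comp fstr_nat fmap_comp compA fstr_nat compA.
- move=> X Y A.
  rewrite actm_idD [RHS]compA -(fstr_assoc F) -[RHS]compA -fmap_comp.
  rewrite -(fstr_assoc G) !fmap_comp !compA; congr (_ \oc _ \oc _).
  by rewrite -!compA fstr_nat.
- by move=> A; rewrite compA fstr_unit -fmap_comp fstr_unit.
Defined.

Definition idT F : modTrans F F.
Proof.
exists (fun A => idm (F A)).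
- by move=> A B f; rewrite comp_idl comp_idr.
- by move=> X A; rewrite actm_id comp_idl comp_idr.
Defined.

Definition compT F G H (t : modTrans G H) (s : modTrans F G) : modTrans F H.
Proof.
exists (fun A => t A \oc s A).
- by move=> A B f; rewrite -compA tr_nat !compA tr_nat.
- by move=> X A; rewrite compA tr_str actm_idD -!compA tr_str.
Defined.

Definition horT F F' G G' (s : modTrans F F') (t : modTrans G G') :
  modTrans (compF F G) (compF F' G').
Proof.
exists (fun A => s (G' A) \oc fmap F (t A)).
- move=> A B f /=.
  by rewrite -compA -fmap_comp (tr_nat t) fmap_comp !compA (tr_nat s).
- move=> X A /=.
  rewrite actm_idD -!compA [in RHS](compA _ (fstr F _ _)) -fstr_nat.
  rewrite -[in RHS]compA -fmap_comp -tr_str fmap_comp !compA.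
  by rewrite -(tr_str s) -!(compA (fstr F' _ _)) (tr_nat s).
Defined.

Definition assocT F G H :
  modTrans (compF (compF F G) H) (compF F (compF G H)).
Proof.
exists (fun A => idm (F (G (H A)))).
- by move=> A B f /=; rewrite comp_idl comp_idr.
- by move=> X A /=; rewrite actm_id comp_idl comp_idr fmap_comp compA.
Defined.

Definition assocVT F G H :
  modTrans (compF F (compF G H)) (compF (compF F G) H).
Proof.
exists (fun A => idm (F (G (H A)))).
- by move=> A B f /=; rewrite comp_idl comp_idr.
- by move=> X A /=; rewrite actm_id comp_idl comp_idr fmap_comp compA.
Defined.

Definition lunitT F : modTrans (compF idF F) F.
Proof.
apply: (@ModTrans K C M (compF idF F) F (fun A => idm (F A))).
- by move=> A B f /=; rewrite comp_idl comp_idr.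
- by move=> X A /=; rewrite actm_id !comp_idl comp_idr.
Defined.

Definition lunitVT F : modTrans F (compF idF F).
Proof.
apply: (@ModTrans K C M F (compF idF F) (fun A => idm (F A))).
- by move=> A B f /=; rewrite comp_idl comp_idr.
- by move=> X A /=; rewrite actm_id !comp_idl comp_idr.
Defined.

Definition runitT F : modTrans (compF F idF) F.
Proof.
apply: (@ModTrans K C M (compF F idF) F (fun A => idm (F A))).
- by move=> A B f /=; rewrite comp_idl comp_idr.
- by move=> X A /=; rewrite actm_id fmap_id comp_idl !comp_idr.
Defined.

Definition runitVT F : modTrans F (compF F idF).
Proof.
apply: (@ModTrans K C M F (compF F idF) (fun A => idm (F A))).
- by move=> A B f /=; rewrite comp_idl comp_idr.
- by move=> X A /=; rewrite actm_id fmap_id comp_idl !comp_idr.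
Defined.

Definition dual_linCat : linCat K.
Proof.
apply: (@LinCat K (modFunctor M) (fun F G => modTrans F G : lmodType K) idT compT).
- by move=> F G s; apply: modTransP => A; exact: comp_idl.
- by move=> F G s; apply: modTransP => A; exact: comp_idr.
- by move=> E F G H u t s; apply: modTransP => A; exact: compA.
- by move=> F G H s a t u; apply: modTransP => A; exact: (comp_linl (s A)).
- by move=> F G H s a t u; apply: modTransP => A; exact: (comp_linr (s A)).
Defined.

(* Fun_C(M, M); the associator and unitors are componentwise identities.      *)
Definition dual_cat : tensorCat K.
Proof.
apply: (@TensorCat K dual_linCat idF compF (@horT) assocT assocVT lunitT runitT).
- move=> F F' G G' t a r s; apply: modTransP => A; exact: (comp_linl (fmap F (t A))).
- move=> F F' G G' t a r s; apply: modTransP => A /=.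
  by rewrite (fmap_lin F) (comp_linr (t (G' A))).
- by move=> F G; apply: modTransP => A /=; rewrite fmap_id comp_idl.
- move=> F F' F'' G G' G'' s' s t' t; apply: modTransP => A /=.
  by rewrite fmap_comp -!compA (compA _ (fmap F _)) (tr_nat s) -!compA.
- by move=> F G H; split; apply: modTransP => A /=; rewrite comp_idl.
- by move=> F; exists (lunitVT F); split; apply: modTransP => A /=; rewrite comp_idl.
- by move=> F; exists (runitVT F); split; apply: modTransP => A /=; rewrite comp_idl.
- move=> F F' G G' H H' f g h; apply: modTransP => A /=.
  by rewrite comp_idl comp_idr fmap_comp compA.
- by move=> F F' f; apply: modTransP => A /=; rewrite !comp_idl comp_idr.
- by move=> F F' f; apply: modTransP => A /=; rewrite fmap_id comp_idl.
- by move=> E F G H; apply: modTransP => A /=; rewrite !fmap_id !comp_idl.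
- by move=> F G; apply: modTransP => A /=; rewrite !fmap_id !comp_idl.
Defined.

End Dual.

(* Main.v *)
From mathcomp Require Import all_boot all_order all_algebra.
From mathcomp Require Import boolp classical_sets topology normedtype derive.
Require Import Defs.

(** The argument takes place in Grothendieck groups. Write D for the dual
    category. Choose representatives S k of the simple objects of M. Objects
    of C act on the Grothendieck group of M by matrices of natural numbers,
    and so do the module functors in D; the two actions commute, by the
    structure isomorphisms F (X . A) = X . F A.

    Let X be the sum of the simple objects of C. Since M is indecomposable and
    C is rigid, every S k occurs in X . S j: the relation that S k occurs in
    some Z . S j is reflexive and transitive, it is symmetric because duality
    transposes a nonzero map Z . S j -> S k into a nonzero map
    S j -> Z' . S k, and its classes would decompose M
    ([indecomposable_reach]). So the matrix of X is positive and has a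
    positive eigenvector d ([perron]). For a fixed nonzero object A of M,
    Y -> d (Y . A) is a positive function on the simple objects Y of C which is
    an eigenvector of multiplication by X; hence the Perron eigenvalue is
    FPdim X, an integer by hypothesis ([perron_weight]). The Perron eigenspace
    is a line, and as its eigenvalue is rational the line is spanned by an
    integer vector ([integer_perron_vector]).

    A module functor F commutes with X, so it preserves this line and acts on
    it by a scalar t_F. As an eigenvalue of a matrix of natural numbers with an
    integer eigenvector, t_F is rational and an algebraic integer, hence an
    integer ([integer_character]). Finally F -> t_F is additive, multiplicative
    for composition, and positive on nonzero functors. Such a character of the
    Grothendieck ring of D is a positive eigenvector of the matrix of every F,
    with eigenvalue t_F, and a positive eigenvector belongs to the largest
    eigenvalue ([positive_eigenvector_largest]); so t_F = FPdim F. *)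

Set Implicit Arguments.
Unset Strict Implicit.
Unset Printing Implicit Defensive.

Import Order.TTheory GRing.Theory Num.Theory.
Import numFieldNormedType.Exports.
Local Open Scope ring_scope.

Lemma dependent_choice (I : Type) (T : I -> Type) (P : forall i, T i -> Prop) :
  (forall i, exists x, P i x) -> exists f : forall i, T i, forall i, P i (f i).
Proof.
by move=> exP; exists (fun i => sval (cid (exP i))) => i; exact: (svalP (cid _)).
Qed.

(** * Dimension of a linear space *)

Section LinearSpaces.
Variables (K : fieldType) (V : lmodType K).

Definition is_basis (I : finType) (e : I -> V) : Prop :=
  (forall v, exists c : I -> K, v = \sum_i c i *: e i) /\
  (forall c : I -> K, \sum_i c i *: e i = 0 -> forall i, c i = 0).

(** The free vectors f j are combinations of the e i, and the matrix of
    coefficients has independent rows. *)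
Lemma card_free_le_span (I J : finType) (e : I -> V) (f : J -> V) :
  (forall v, exists c : I -> K, v = \sum_i c i *: e i) ->
  (forall c : J -> K, \sum_j c j *: f j = 0 -> forall j, c j = 0) ->
  (#|J| <= #|I|)%N.
Proof.
move=> span_e free_f.
have [c fE] := choice (fun j => span_e (f j)).
pose A : 'M[K]_(#|J|, #|I|) := \matrix_(j, i) c (enum_val j) (enum_val i).
suff Afree : row_free A by rewrite -(eqP Afree) rank_leq_col.
apply: inj_row_free => v vA0; apply/rowP => j0; rewrite mxE.
pose c' j := v 0 (enum_rank j).
suff /free_f/(_ (enum_val j0)) : \sum_j c' j *: f j = 0.
  by rewrite /c' enum_valK.
under eq_bigr do rewrite fE scaler_sumr.
rewrite exchange_big big1 // => i _ /=.
under eq_bigr do rewrite scalerA.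
rewrite -scaler_suml (reindex _ (onW_bij _ (enum_val_bij J))) /=.
have /(congr1 (fun B : 'rV_ _ => B 0 (enum_rank i))) := vA0.
rewrite !mxE => E; rewrite [X in X *: _](_ : _ = 0) ?scale0r // -[RHS]E.
by apply: eq_bigr => j _; rewrite /c' enum_valK mxE enum_rankK.
Qed.

Lemma basis_card (I J : finType) (e : I -> V) (f : J -> V) :
  is_basis e -> is_basis f -> #|I| = #|J|.
Proof.
move=> [se fe] [sf ff]; apply/eqP.
by rewrite eqn_leq (card_free_le_span sf fe) (card_free_le_span se ff).
Qed.

(** A spanning family of least size is a basis. *)
Lemma finite_dim_basis :
  finite_dim V -> exists n (e : 'I_n -> V), is_basis e.
Proof.
move=> fd.
pose P n := `[< exists e : 'I_n -> V,
  forall v, exists c : 'I_n -> K, v = \sum_i c i *: e i >].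
have exP : exists n, P n by case: fd => n e; exists n; apply/asboolP.
case: (ex_minnP exP) => n /asboolP[e span_e] min_n.
exists n, e; split=> // c ce0 j; apply: contrapT => /eqP cj0.
case: n e span_e c ce0 j cj0 min_n => [|n] e span_e c ce0 j cj0 min_n.
  by case: j {cj0}.
suff /min_n : P n by rewrite ltnn.
apply/asboolP; exists (fun i => e (lift j i)) => v.
have [b ->] := span_e v.
move: ce0; rewrite !(bigD1_ord j) //= => /eqP; rewrite addr_eq0 => /eqP ejE.
exists (fun i => b (lift j i) - b j / c j * c (lift j i)).
under [RHS]eq_bigr do rewrite scalerBl -scalerA.
rewrite sumrB -scaler_sumr addrC; congr (_ + _).
by rewrite -scalerN -ejE scalerA divfK.
Qed.

(** A total function, so that dimensions can be summed and compared before a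
    basis is named; its value is 0 on spaces without a finite basis. *)
Definition ldim : nat :=
  if pselect (exists n (e : 'I_n -> V), is_basis e) is left h
  then sval (cid h) else 0%N.

Lemma ldim_basis : finite_dim V -> exists e : 'I_ldim -> V, is_basis e.
Proof.
move=> /finite_dim_basis h; rewrite /ldim; case: pselect => // h'.
exact: (svalP (cid h')).
Qed.

Lemma ldimE (I : finType) (e : I -> V) : is_basis e -> ldim = #|I|.
Proof.
move=> be; have [|f bf] := ldim_basis.
  exists #|I|, (fun i => e (enum_val i)) => v; case: (be.1 v) => c ->.
  exists (fun i => c (enum_val i)).
  by rewrite (reindex _ (onW_bij _ (enum_val_bij I))).
by rewrite (basis_card be bf) card_ord.
Qed.

Lemma ldim_eq0 : finite_dim V -> (ldim == 0)%N <-> (forall v : V, v = 0).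
Proof.
move=> fd; split=> [/eqP d0 v|V0].
  have [e [se _]] := ldim_basis fd; have [c ->] := se v.
  by rewrite big1 // => i _; exfalso; case: i => i; rewrite d0.
apply/eqP; rewrite (@ldimE 'I_0 (fun=> 0)) ?card_ord //.
by split=> [v|c _ []//]; exists (fun=> 0); rewrite big_ord0.
Qed.

End LinearSpaces.

(** * Linear categories and direct sums *)

Section LinearCategory.
Variables (K : fieldType) (C : linCat K).
Implicit Types X Y Z : C.

Lemma comp0l X Y Z (f : hom X Y) : (0 : hom Y Z) \oc f = 0.
Proof. exact: lin0 (comp_linl f). Qed.

Lemma comp0r X Y Z (g : hom Y Z) : g \oc (0 : hom X Y) = 0.
Proof. exact: lin0 (comp_linr g). Qed.

Lemma compZl X Y Z (f : hom X Y) a (g : hom Y Z) :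
  (a *: g) \oc f = a *: (g \oc f).
Proof. exact: (linZ (comp_linl f)). Qed.

Lemma compZr X Y Z (g : hom Y Z) a (f : hom X Y) :
  g \oc (a *: f) = a *: (g \oc f).
Proof. exact: (linZ (comp_linr g)). Qed.

Lemma comp_suml X Y Z (f : hom X Y) (I : finType) (P : pred I)
    (g : I -> hom Y Z) :
  (\sum_(i | P i) g i) \oc f = \sum_(i | P i) (g i \oc f).
Proof.
exact: (big_morph (fun g => g \oc f) (linD (comp_linl f)) (@comp0l X Y Z f)).
Qed.

Lemma comp_sumr X Y Z (g : hom Y Z) (I : finType) (P : pred I)
    (f : I -> hom X Y) :
  g \oc (\sum_(i | P i) f i) = \sum_(i | P i) (g \oc f i).
Proof.
exact: (big_morph (fun f => g \oc f) (linD (comp_linr g)) (@comp0r X Y Z g)).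
Qed.

Lemma zero_homr X Y (f : hom X Y) : is_zero Y -> f = 0.
Proof. by move=> Y0; rewrite -(comp_idl f) Y0 comp0l. Qed.

Lemma iso_sym X Y : iso X Y -> iso Y X.
Proof. by case=> f [g [gf fg]]; exists g, f. Qed.

Lemma iso_zero X Y : iso X Y -> is_zero X -> is_zero Y.
Proof.
by case=> f [g [_ fg]] X0; rewrite /is_zero -fg (zero_homr g X0) comp0r.
Qed.

Lemma iso_inj X Y Z (u : hom X Y) (v : hom Y Z) :
  is_iso u -> v \oc u = 0 -> v = 0.
Proof.
by case=> w [_ uw] vu0; rewrite -(comp_idr v) -uw compA vu0 comp0l.
Qed.

(** A nonzero morphism of simple objects has a zero kernel, so it is a nonzero
    subobject of its target. *)
Lemma schur X Y (f : hom X Y) :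
  abelian_cat C -> simple_obj X -> simple_obj Y -> f <> 0 -> is_iso f.
Proof.
move=> [_ kerC _ _ _] sX sY f0; have [Z [k [fk0 ku]]] := kerC _ _ f.
have kmono : is_mono k.
  move=> W u v kuv; have [|w [_ wP]] := ku W (k \oc u).
    by rewrite compA fk0 comp0l.
  by rewrite -(wP u) // -(wP v).
case: (sX.2 _ k kmono) => [Z0|kiso]; last by case: f0; exact: iso_inj kiso fk0.
suff fmono : is_mono f by case: (sY.2 _ f fmono) => // /sX.1.
move=> W u v fuv; have [|w [kw _]] := ku W (u - v).
  by rewrite (linD (comp_linr f)) (linN (comp_linr f)) fuv subrr.
by apply/eqP; rewrite -subr_eq0 -kw (zero_homr w Z0) comp0r.
Qed.

Lemma dsum_iso (I J : finType) (F : I -> C) (G : J -> C) (h : J -> I) X :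
  bijective h -> (forall j, iso (G j) (F (h j))) -> is_dsum F X -> is_dsum G X.
Proof.
move=> bh isoGF [inj [prj [pi pi0 s1]]].
have [u uP] := dependent_choice isoGF; have [v vP] := dependent_choice uP.
exists (fun j => inj (h j) \oc u j), (fun j => v j \oc prj (h j)); split.
- by move=> j; rewrite -compA (compA (prj _)) pi comp_idl (vP j).1.
- move=> j k jk; rewrite -compA (compA (prj _)) pi0 ?comp0l ?comp0r //.
  by rewrite (inj_eq (bij_inj bh)).
- rewrite -s1 (reindex h) /=; last exact: onW_bij.
  by apply: eq_bigr => j _; rewrite -compA (compA (u j)) (vP j).2 comp_idl.
Qed.

Lemma dsum_unit X Y : iso X Y -> is_dsum (fun _ : unit => X) Y.
Proof.
case=> f [g [gf fg]]; exists (fun _ => f), (fun _ => g); split=> //.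
by rewrite (bigD1 tt) //= big1 ?addr0 // => -[].
Qed.

(** The inclusion of A into X and the projection back are assembled from those
    of the terms F i with p i, and likewise for B. *)
Lemma dsum_split (I : finType) (F : I -> C) X (p : pred I) A B :
  is_dsum F X -> is_dsum (fun i : {i | p i} => F (val i)) A ->
  is_dsum (fun i : {i | ~~ p i} => F (val i)) B -> is_dsum2 A B X.
Proof.
move=> [inj [prj [pi pi0 s1]]].
have emb (q : pred I) D : is_dsum (fun i : {i | q i} => F (val i)) D ->
    exists (a : hom D X) (b : hom X D),
    [/\ b \oc a = idm D, a \oc b = \sum_(i | q i) (inj i \oc prj i),
        forall i, ~~ q i -> prj i \oc a = 0
      & forall W (f : hom W X),
          (forall i, q i -> prj i \oc f = 0) -> b \oc f = 0].
  case=> inj' [prj' [pi' pi0' s1']].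
  pose a := \sum_i (inj (val i) \oc prj' i).
  have prja i : prj (val i) \oc a = prj' i.
    rewrite comp_sumr (bigD1 i) //= big1 ?addr0 ?compA ?pi ?comp_idl //.
    by move=> k ki; rewrite compA pi0 ?comp0l.
  exists a, (\sum_i (inj' i \oc prj (val i))); split.
  - rewrite comp_suml -s1'; apply: eq_bigr => i _.
    by rewrite -compA prja.
  - rewrite comp_sumr (eq_bigr (fun i => inj (val i) \oc prj (val i))); last first.
      move=> i _; rewrite compA comp_suml (bigD1 i) //= big1 ?addr0.
        by rewrite -(compA (inj _)) pi' comp_idr.
      by move=> k ki; rewrite -compA pi0' ?comp0r // eq_sym.
    by rewrite -(big_sub q (fun i => inj i \oc prj i)).
  - move=> i nqi; rewrite comp_sumr big1 // => j _; rewrite compA pi0 ?comp0l //.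
    by apply: contraNneq nqi => <-; exact: valP.
  - move=> W f prjf; rewrite comp_suml big1 // => i _.
    by rewrite -compA prjf ?comp0r //; exact: valP.
move=> /emb[a [b [ba ab a0 b0]]] /emb[a' [b' [ba' ab' a0' b0']]].
exists (fun c : bool => if c return hom (if c then A else B) X then a else a'),
  (fun c : bool => if c return hom X (if c then A else B) then b else b').
split; first by case.
- case=> -[] // _.
    by apply: b0' => i ni; exact: a0.
  by apply: b0 => i pi'; apply: a0'; rewrite pi'.
- by rewrite big_bool ab ab' -s1 [RHS](bigID p).
Qed.

(** These are the additive functions on the Grothendieck group. *)
Definition additive_fun (V : nmodType) (phi : C -> V) : Prop :=
  forall (I : finType) (F : I -> C) X,
    is_dsum F X -> phi X = \sum_i phi (F i).

Lemma additive_iso (V : nmodType) (phi : C -> V) X Y :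
  additive_fun phi -> iso X Y -> phi X = phi Y.
Proof.
move=> add_phi /dsum_unit/add_phi ->.
by rewrite (bigD1 tt) //= big1 ?addr0 // => -[].
Qed.

Lemma additive_zero (V : nmodType) (phi : C -> V) X :
  additive_fun phi -> is_zero X -> phi X = 0.
Proof.
move=> add_phi X0.
have /add_phi -> : is_dsum (fun _ : 'I_0 => X) X; last by rewrite big_ord0.
by exists (fun=> 0), (fun=> 0); split; [case|case|rewrite big_ord0].
Qed.

(** If the F i have bases, composing them with the inclusions gives a basis of
    morphisms into the sum. *)
Lemma ldim_hom_additive P :
  (forall X Y, finite_dim (hom X Y)) ->
  additive_fun (fun X => ldim (hom P X) : nat).
Proof.
move=> fd I F X [inj [prj [pi pi0 s1]]].
have [e be] := dependent_choice (fun i => ldim_basis (fd P (F i))).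
pose J := {i & 'I_(ldim (hom P (F i)))}.
have bJ : is_basis (fun p : J => inj (tag p) \oc e _ (tagged p)).
  split=> [v|c c0].
    have [c cP] := dependent_choice (fun i => (be i).1 (prj i \oc v)).
    exists (fun p => c (tag p) (tagged p)).
    rewrite -(sig_big_dep xpredT (fun=> xpredT)
      (fun i (j : 'I_(ldim (hom P (F i)))) => c i j *: (inj i \oc e i j))) /=.
    rewrite -[LHS]comp_idl -s1 comp_suml; apply: eq_bigr => i _.
    rewrite -compA cP comp_sumr; apply: eq_bigr => j _; exact: compZr.
  case=> i j; pose ci k := c (existT (fun i => 'I_(ldim (hom P (F i)))) i k).
  suff ci0 : \sum_k ci k *: e i k = 0 by exact: ((be i).2 ci ci0 j).
  have /(congr1 (fun f => prj i \oc f)) := c0; rewrite comp0r comp_sumr.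
  rewrite (eq_bigr (fun p : J =>
    c (Tagged _ (tagged p)) *: (prj i \oc inj (tag p) \oc e _ (tagged p)))).
    rewrite -(sig_big_dep xpredT (fun=> xpredT)
      (fun i' (j : 'I_(ldim (hom P (F i')))) =>
         c (Tagged _ j) *: (prj i \oc inj i' \oc e i' j))) /=.
    rewrite (bigD1 i) //= [X in _ + X]big1 ?addr0.
      move=> sum0; rewrite -[RHS]sum0; apply: eq_bigr => k _.
      by rewrite /ci pi comp_idl; congr (c _ *: _).
    by move=> k ki; rewrite big1 // => l _; rewrite pi0 // comp0l scaler0.
  by case=> i' j' _ /=; rewrite compZr compA.
rewrite (ldimE bJ) card_tagged sumnE big_map big_enum.
by apply: eq_bigr => i _; rewrite card_ord.
Qed.

End LinearCategory.

Lemma dsum_functor (K : fieldType) (C D : linCat K) (fo : C -> D)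
    (fm : forall X Y, hom X Y -> hom (fo X) (fo Y)) :
  (forall X Y, linear (@fm X Y)) -> (forall X, fm X X (idm X) = idm (fo X)) ->
  (forall X Y Z (g : hom Y Z) (f : hom X Y),
     fm X Z (g \oc f) = fm Y Z g \oc fm X Y f) ->
  forall (I : finType) (F : I -> C) X,
    is_dsum F X -> is_dsum (fun i => fo (F i)) (fo X).
Proof.
move=> flin fid fcomp I F X [inj [prj [pi pi0 s1]]].
exists (fun i => fm _ _ (inj i)), (fun i => fm _ _ (prj i)); split.
- by move=> i; rewrite -fcomp pi.
- by move=> i j ij; rewrite -fcomp pi0 // (lin0 (flin _ _)).
- rewrite -fid -s1 (big_morph (fm X X) (linD (flin X X)) (lin0 (flin X X))).
  by apply: eq_bigr => i _; rewrite fcomp.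
Qed.

(** * Multiplicities of simple objects *)

Section Multiplicities.
Variables (K : fieldType) (C : linCat K) (n : nat) (S : 'I_n -> C).
Hypotheses (ssC : finite_semisimple_cat C) (basisS : simple_basis S).
Implicit Types X Y : C.

Let fd X Y : finite_dim (hom X Y).
Proof. by case: ssC. Qed.

Let abC : abelian_cat C.
Proof. by case: ssC => -[]. Qed.

(** Hom(S k, X) is a sum of copies of the division algebra End(S k), so the
    quotient of dimensions counts the copies of S k in X. *)
Definition mult (k : 'I_n) (X : C) : nat :=
  (ldim (hom (S k) X) %/ ldim (hom (S k) (S k)))%N.

Lemma simple_hom j k (f : hom (S j) (S k)) : f <> 0 -> j = k.
Proof.
case: basisS => sS iS _ /(schur abC (sS j) (sS k)) fiso.
by apply: iS; exists f.
Qed.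

Lemma ldim_end_gt0 k : (0 < ldim (hom (S k) (S k)))%N.
Proof.
rewrite lt0n; apply/negP => /(ldim_eq0 (fd _ _)) e0.
by case: basisS => /(_ k) [] + _ _ _; apply; exact: e0.
Qed.

Lemma ldim_hom_simple j k :
  ldim (hom (S j) (S k)) = ((k == j) * ldim (hom (S j) (S j)))%N.
Proof.
case: eqP => [->|kj]; first by rewrite mul1n.
rewrite mul0n; apply/eqP/(ldim_eq0 (fd _ _)) => f.
by apply: contrapT => /simple_hom jk; case: kj.
Qed.

Lemma simple_decomposition X :
  exists (I : finType) (k : I -> 'I_n), is_dsum (fun i => S (k i)) X.
Proof.
case: ssC => -[_ /(_ X) [I [T [sT dT]]]] _ _; exists I.
have [k kP] := choice (fun i => let: And3 _ _ h := basisS in h _ (sT i)).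
exists k; apply: (dsum_iso (h := id) _ _ dT) => [|i]; last exact/iso_sym/kP.
by exists id.
Qed.

Lemma mult_dsum (I : finType) (k : I -> 'I_n) X j :
  is_dsum (fun i => S (k i)) X -> mult j X = #|[pred i | k i == j]|.
Proof.
move=> dX; rewrite /mult (ldim_hom_additive (S j) fd dX).
under eq_bigr do rewrite ldim_hom_simple.
rewrite -[X in (X %/ _)%N]big_distrl /= mulnK ?ldim_end_gt0 //.
by rewrite -sum1_card [RHS]big_mkcond; apply: eq_bigr => i _; rewrite inE; case: eqP.
Qed.

Lemma ldim_homE k X :
  ldim (hom (S k) X) = (mult k X * ldim (hom (S k) (S k)))%N.
Proof.
have [I [l dX]] := simple_decomposition X.
rewrite (mult_dsum k dX) (ldim_hom_additive (S k) fd dX).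
under eq_bigr do rewrite ldim_hom_simple.
rewrite -[LHS]big_distrl /= -sum1_card [in RHS]big_mkcond; congr (_ * _)%N.
Qed.

Lemma mult_additive k : additive_fun (fun X => mult k X).
Proof.
move=> I F X dX; apply/eqP; rewrite -(eqn_pmul2r (ldim_end_gt0 k)); apply/eqP.
rewrite -ldim_homE (ldim_hom_additive (S k) fd dX) [RHS]big_distrl /=.
by apply: eq_bigr => i _; rewrite ldim_homE.
Qed.

Lemma mult_simple k j : mult k (S j) = (j == k).
Proof. by rewrite /mult ldim_hom_simple mulnK ?ldim_end_gt0. Qed.

Lemma mult_neq0P k X : mult k X <> 0%N <-> exists f : hom (S k) X, f <> 0.
Proof.
split=> [m0|[f f0] m0]; last first.
  by apply: f0; move: f; apply/(ldim_eq0 (fd _ _)); rewrite ldim_homE m0.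
apply: contrapT => no_f; apply: m0; rewrite /mult.
suff /(ldim_eq0 (fd _ _))/eqP -> : forall f : hom (S k) X, f = 0 by rewrite div0n.
by move=> f; apply: contrapT => f0; apply: no_f; exists f.
Qed.

(** The classes of the S k generate the Grothendieck group. *)
Lemma additive_expand (V : nmodType) (phi : C -> V) X :
  additive_fun phi -> phi X = \sum_k phi (S k) *+ mult k X.
Proof.
move=> add_phi; have [I [l dX]] := simple_decomposition X.
rewrite (add_phi _ _ _ dX) (partition_big l xpredT) //=.
apply: eq_bigr => k _; rewrite (mult_dsum k dX) -sumr_const.
by apply: eq_big => [i|i /eqP ->]; rewrite ?inE.
Qed.

Lemma exists_mult X : ~ is_zero X -> exists k, mult k X <> 0%N.
Proof.
move=> X0; have [I [l dX]] := simple_decomposition X.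
apply: contrapT => no_k; case: dX (dX) => [inj [prj [_ _ s1]]] dX.
apply: X0; rewrite /is_zero -s1 big1 // => i _; case: no_k.
exists (l i); rewrite (mult_dsum _ dX); apply/eqP.
by rewrite -lt0n; apply/card_gt0P; exists i; rewrite inE.
Qed.

Lemma common_constituent X Y (f : hom X Y) :
  f <> 0 -> exists k, mult k X <> 0%N /\ mult k Y <> 0%N.
Proof.
move=> f0; have [I [l [inj [prj [pi pi0 s1]]]]] := simple_decomposition X.
have [i finj] : exists i, f \oc inj i <> 0.
  apply: contrapT => no_i; apply: f0.
  rewrite -(comp_idr f) -s1 comp_sumr big1 // => i _.
  rewrite compA [f \oc _](_ : _ = 0) ?comp0l //.
  by apply: contrapT => fi; apply: no_i; exists i.
exists (l i); split; apply/mult_neq0P; last by exists (f \oc inj i).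
by exists (inj i) => inj0; apply: finj; rewrite inj0 comp0r.
Qed.

(** A constituent is a direct summand. *)
Lemma mult_neq0_to k X : mult k X <> 0%N -> exists f : hom X (S k), f <> 0.
Proof.
have [I [l dX]] := simple_decomposition X; rewrite (mult_dsum k dX).
have [i /eqP <- _|no_i []] := pickP [pred i | l i == k]; last exact: eq_card0.
case: dX => inj [prj [pi _ _]]; exists (prj i) => prj0.
by case: basisS => /(_ (l i)) [] + _ _ _; apply; rewrite /is_zero -pi prj0 comp0l.
Qed.

(** N is a function of its own, so that it may be a row of a matrix. *)
Lemma mult_decomposition X (N : 'I_n -> nat) :
  (forall j, N j = mult j X) ->
  is_dsum (fun p : {j : 'I_n & 'I_(N j)} => S (tag p)) X.
Proof.
move=> NE; have [I [l dX]] := simple_decomposition X.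
have cardE j : N j = #|[pred i | l i == j]| by rewrite NE; exact: mult_dsum.
pose h (p : {j : 'I_n & 'I_(N j)}) : I :=
  enum_val (cast_ord (cardE (tag p)) (tagged p)).
have lh p : l (h p) = tag p.
  by have := enum_valP (cast_ord (cardE (tag p)) (tagged p)); rewrite inE => /eqP.
apply: (dsum_iso (h := h) _ _ dX) => [|p]; last first.
  by rewrite lh; exists (idm _); exact: is_iso_id.
have h_inj : injective h.
  move=> [j a] [k b] e.
  have /= jk := etrans (esym (lh (existT _ j a)))
    (etrans (congr1 l e) (lh (existT _ k b))).
  by move: b e; rewrite -jk => b /enum_val_inj/cast_ord_inj /= ->.
apply: inj_card_bij => //; rewrite card_tagged sumnE big_map big_enum /=.
rewrite -sum1_card (partition_big l xpredT) //=; apply: leq_sum => j _.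
by rewrite card_ord cardE sum1_card.
Qed.

End Multiplicities.

(** * Module categories *)

Section ModuleCategory.
Variables (K : fieldType) (C : tensorCat K) (M : moduleCat C).
Implicit Types (X Y : C) (A B : M).

Lemma actm_comp_idr X Y Z A (g : hom Y Z) (f : hom X Y) :
  (g \oc f) \actm idm A = (g \actm idm A) \oc (f \actm idm A).
Proof. by rewrite -actm_comp comp_idl. Qed.

Lemma act_dsuml (I : finType) (F : I -> C) X A :
  is_dsum F X -> is_dsum (fun i => F i \act A) (X \act A).
Proof.
apply: (dsum_functor (fo := fun X => X \act A) (fm := fun X Y f => f \actm idm A)).
- by move=> *; exact: actm_linl.
- by move=> *; exact: actm_id.
- by move=> *; exact: actm_comp_idr.
Qed.

Lemma act_dsumr (I : finType) (F : I -> M) X A :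
  is_dsum F A -> is_dsum (fun i => X \act F i) (X \act A).
Proof.
apply: (dsum_functor (fo := fun A => X \act A) (fm := fun A B f => idm X \actm f)).
- by move=> *; exact: actm_linr.
- by move=> *; exact: actm_id.
- by move=> *; exact: actm_idD.
Qed.

Lemma act_assoc X Y A : iso ((X \ox Y) \act A) (X \act (Y \act A)).
Proof. by exists (massoc X Y A); exact: massoc_iso. Qed.

Lemma act_unit A : iso (tunit C \act A) A.
Proof. by exists (munit A); exact: munit_iso. Qed.

Lemma is_iso_actl X Y A (f : hom X Y) : is_iso f -> is_iso (f \actm idm A).
Proof.
by case=> g [gf fg]; exists (g \actm idm A); split;
  rewrite -actm_comp_idr ?gf ?fg actm_id.
Qed.

Lemma act_zero X A : is_zero A -> is_zero (X \act A).
Proof. by move=> A0; rewrite /is_zero -actm_id A0 (lin0 (actm_linr _)). Qed.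

(** The zigzag identity says that this composite is the identity of X up to
    unitors. *)
Lemma zigzag_iso X X' (ev : hom (X \ox X') (tunit C))
    (coev : hom (tunit C) (X' \ox X)) :
  lunit X \oc (ev \oxm idm X) \oc assocV X X' X \oc (idm X \oxm coev) = runit X ->
  is_iso ((ev \oxm idm X) \oc assocV X X' X \oc (idm X \oxm coev)).
Proof.
move=> zz; have [l [lK Kl]] := lunit_iso X.
suff -> : (ev \oxm idm X) \oc assocV X X' X \oc (idm X \oxm coev) = l \oc runit X.
  apply: is_iso_comp; last exact: runit_iso.
  by exists (lunit X).
by rewrite -zz -!compA (compA l) lK comp_idl.
Qed.

(** The transpose of g under the adjunction between X and X' is
    h = (X' . g) o coev. If h = 0 then g composed with the action of the zigzag
    isomorphism on A, which passes through X . h, is 0 as well. *)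
Lemma transpose_neq0 X X' A B (g : hom (X \act A) B) :
  is_dual X X' -> g <> 0 -> exists h : hom A (X' \act B), h <> 0.
Proof.
move=> [ev [coev [_ /zigzag_iso]]]; set Z := (Z in is_iso Z) => Ziso g0.
have [u [uK Ku]] := munit_iso A.
pose h1 := (idm X' \actm g) \oc massoc X' X A \oc (coev \actm idm A).
exists (h1 \oc u) => /iso_inj h0; apply: g0.
have {h0} h1_0 : h1 = 0 by apply: h0; exists (munit A).
suff g1 : (idm (tunit C) \actm g) \oc (massoc (tunit C) X A \oc (Z \actm idm A)) = 0.
  have {g1} g1 : idm (tunit C) \actm g = 0.
    apply: iso_inj g1; apply: is_iso_comp; first exact: massoc_iso.
    exact: is_iso_actl.
  have := munit_nat g; rewrite g1 comp0r => /esym; apply: iso_inj.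
  exact: munit_iso.
have [m [mK Km]] := massoc_iso X X' (X \act A).
have [mB [mBK KmB]] := massoc_iso X X' B.
(* The module pentagon for X, X', X, A, solved for m. *)
have pent : massoc (X \ox X') X A \oc (assocV X X' X \actm idm A) =
    m \oc (idm X \actm massoc X' X A) \oc massoc X (X' \ox X) A.
  rewrite -[LHS]comp_idl -mK -compA (compA (massoc X X' _)) mpentagon.
  by rewrite -!compA -actm_comp_idr (assocK _ _ _).2 actm_id comp_idr.
have natg : (idm (X \ox X') \actm g) \oc m = mB \oc (idm X \actm (idm X' \actm g)).
  rewrite -[LHS]comp_idl -mBK -!compA (compA (massoc X X' B)) -tmor_id.
  by rewrite massoc_nat -compA Km comp_idr.
have natev : massoc (tunit C) X A \oc ((ev \oxm idm X) \actm idm A) =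
    (ev \actm idm (X \act A)) \oc massoc (X \ox X') X A.
  by rewrite massoc_nat actm_id.
have natcoev : massoc X (X' \ox X) A \oc ((idm X \oxm coev) \actm idm A) =
    (idm X \actm (coev \actm idm A)) \oc massoc X (tunit C) A.
  exact: massoc_nat.
have evg : (idm (tunit C) \actm g) \oc (ev \actm idm (X \act A)) =
    (ev \actm idm B) \oc (idm (X \ox X') \actm g).
  by rewrite -!actm_comp !comp_idl !comp_idr.
rewrite /Z !actm_comp_idr !compA -(compA _ (massoc _ _ _)) natev.
rewrite !compA evg -(compA _ (massoc _ _ _)) pent.
rewrite -!compA natcoev !compA -(compA _ (idm (X \ox X') \actm g) m) natg.
rewrite !compA -(compA _ _ (idm X \actm massoc _ _ _)) -actm_idD.
rewrite -(compA _ _ (idm X \actm (coev \actm _))) -actm_idD -/h1 h1_0.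
by rewrite (lin0 (actm_linr _)) comp0r comp0l.
Qed.

(** The unit is simple, hence a direct summand of X' (x) X, so A is a direct
    summand of X' . (X . A). *)
Lemma act_neq0 X A :
  is_fusion C -> ~ is_zero X -> ~ is_zero A -> ~ is_zero (X \act A).
Proof.
move=> [[ssC _ _] rigC bijC] X0 A0 XA0; have [_ [X' dualX]] := rigC X.
have [ev [coev [_ /zigzag_iso Ziso]]] := dualX.
have coev0 : coev <> 0.
  move=> c0; apply: X0; move: Ziso; rewrite c0 (lin0 (tmor_linr _)) comp0r.
  case=> w [_ ]; rewrite comp0l => id0; rewrite /is_zero.
  have [l [_ Kl]] := lunit_iso X.
  by rewrite -Kl -(comp_idr (lunit X)) -id0 comp0r comp0l.
have one0 : ~ is_zero (tunit C).
  move=> one0; have := bij_inj bijC; move/(_ 1 0).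
  by rewrite one0 !scaler0 => /(_ erefl)/eqP; rewrite oner_eq0.
(* A simple summand T of 1 gives an idempotent of End(1) = K, a scalar c. On T
   this scalar acts as the identity, so c = 1 and T is the whole of 1. *)
have [T [t [tiso sT]]] : exists (T : C) (t : hom T (tunit C)), is_iso t /\ simple_obj T.
  have [I [T [sT [inj [prj [pi _ s1]]]]]] := ssC.2 (tunit C).
  have [i _] : exists i : I, True.
    apply: contrapT => no_i; apply: one0; rewrite /is_zero -s1 big1 // => i _.
    by case: no_i; exists i.
  exists (T i), (inj i); split=> //.
  have [sc _ Ksc] := bijC; pose c := sc (inj i \oc prj i).
  have cE : inj i \oc prj i = c *: idm (tunit C) by rewrite /c Ksc.
  have cid : c *: idm (T i) = idm (T i).
    rewrite -[in LHS](pi i) -compZr -[inj i]comp_idl -compZl -cE.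
    by rewrite -compA pi comp_idr pi.
  have c1 : c = 1.
    apply/eqP; rewrite -subr_eq0; apply/negPn/negP => c1; apply: (sT i).1.
    apply/eqP; move/eqP: cid; rewrite -subr_eq0 -{2}[idm _]scale1r -scalerBl.
    by rewrite scaler_eq0 (negPf c1).
  by exists (prj i); rewrite /is_inv pi cE c1 scale1r.
(* coev is nonzero on the simple object 1, so some component of it is an
   isomorphism onto a summand of X' (x) X. *)
have [r rP] : exists r : hom (X' \ox X) (tunit C), r \oc coev = idm (tunit C).
  have [I [U [sU [inj [prj [_ _ s1]]]]]] := ssC.2 (X' \ox X).
  have [i pc0] : exists i, prj i \oc coev \oc t <> 0.
    apply: contrapT => no_i; apply: coev0; apply: (iso_inj tiso).
    rewrite -[coev]comp_idl -s1 !comp_suml big1 // => i _.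
    rewrite -!compA (compA (prj i)) [X in inj i \oc X](_ : _ = 0) ?comp0r //.
    by apply: contrapT => h; apply: no_i; exists i.
  have [s [sK _]] := schur ssC.1 sT (sU i) pc0.
  have [t' [_ Kt]] := tiso; exists (t \oc s \oc prj i).
  have := congr1 (comp t) sK; rewrite comp_idr !compA => E.
  by rewrite -[LHS]comp_idr -Kt compA E.
apply/A0/(iso_zero (act_unit A)).
rewrite /is_zero -actm_id -rP actm_comp_idr [coev \actm _]zero_homr ?comp0r //.
by apply: iso_zero (iso_sym (act_assoc X' X A)) _; exact: act_zero.
Qed.

End ModuleCategory.

(** * Indecomposability *)

Section Connected.
Variables (K : fieldType) (C : tensorCat K) (M : moduleCat C).
Variables (m : nat) (S : 'I_m -> M).
Hypotheses (rigC : rigid_cat C) (ssM : finite_semisimple_cat M).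
Hypothesis basisS : simple_basis S.

Let mult_add := mult_additive ssM basisS.

Lemma mult_act_additive X k : additive_fun (fun A : M => mult S k (X \act A)).
Proof. by move=> I F A /(act_dsumr X)/(mult_add k). Qed.

Definition reach (j k : 'I_m) : Prop := exists X : C, mult S k (X \act S j) <> 0%N.

Lemma mult_act_neq0 X A k :
  mult S k (X \act A) <> 0%N <->
  exists j, mult S j A <> 0%N /\ mult S k (X \act S j) <> 0%N.
Proof.
rewrite (additive_expand ssM basisS A (mult_act_additive X k)); split.
  move=> s0; apply: contrapT => no_j; apply: s0; rewrite big1 // => j _.
  have [->|Aj] := eqVneq (mult S j A) 0%N; first by rewrite mulr0n.
  have [->|Xj] := eqVneq (mult S k (X \act S j)) 0%N; first by rewrite mul0rn.
  by case: no_j; exists j; split; apply/eqP.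
case=> j [/eqP Aj /eqP Xj]; apply/eqP; rewrite (bigD1 j) //= -lt0n.
by rewrite addn_gt0 -mulr_natr natn muln_gt0 !lt0n Xj Aj.
Qed.

Lemma reach_refl j : reach j j.
Proof.
exists (tunit C); rewrite (additive_iso (mult_add j) (act_unit (S j))).
by rewrite (mult_simple ssM basisS) eqxx.
Qed.

Lemma reach_trans j k l : reach j k -> reach k l -> reach j l.
Proof.
move=> [X Xk] [Y Yl]; exists (Y \ox X).
rewrite (additive_iso (mult_add l) (act_assoc Y X (S j))).
by apply/mult_act_neq0; exists k.
Qed.

Lemma reach_sym j k : reach j k -> reach k j.
Proof.
move=> [X /(mult_neq0_to ssM basisS)[g g0]]; have [_ [X' dualX]] := rigC X.
have [h h0] := transpose_neq0 dualX g0.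
by exists X'; apply/(mult_neq0P ssM basisS); exists h.
Qed.

Lemma module_subcat_constituents (P : 'I_m -> Prop) :
  (forall j k, P j -> reach j k -> P k) ->
  module_subcat (fun A : M => forall k, mult S k A <> 0%N -> P k).
Proof.
move=> closedP; split.
- by move=> A B AB PA k; rewrite -(additive_iso (mult_add k) AB); exact: PA.
- move=> I F A dA PF k; rewrite (mult_add k dA) => s0.
  have [i Fi] : exists i, mult S k (F i) <> 0%N.
    apply: contrapT => no_i; apply: s0; rewrite big1 // => i _.
    by apply: contrapT => Fi; apply: no_i; exists i.
  exact: PF Fi.
- move=> I F A dA PA i k /eqP Fi; apply: PA; rewrite (mult_add k dA).
  by apply/eqP; rewrite (bigD1 i) //= -lt0n addn_gt0 lt0n Fi.
- move=> X A PA k /mult_act_neq0[j [Aj Xj]].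
  by apply: closedP (PA j Aj) _; exists X.
Qed.

(** The sums of simple objects inside the reachability class of j, and the sums
    of those outside of it, are module subcategories with M as direct sum. *)
Lemma indecomposable_reach : indecomposable M -> forall j k, reach j k.
Proof.
move=> [_ indM] j k; apply: contrapT => njk; apply: indM.
exists (fun A : M => forall l, mult S l A <> 0%N -> reach j l).
exists (fun A : M => forall l, mult S l A <> 0%N -> ~ reach j l).
have simple_self l (P : 'I_m -> Prop) : P l ->
    nonzero_subcat (fun A : M => forall k, mult S k A <> 0%N -> P k).
  move=> Pl; exists (S l); split; last by case: basisS => sS _ _; exact: (sS l).1.
  by move=> i; rewrite (mult_simple ssM basisS); case: eqP => // <-.
split.
- by apply: module_subcat_constituents => a b; exact: reach_trans.
- apply: module_subcat_constituents => a b ja ab jb; apply: ja.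
  exact: reach_trans jb (reach_sym ab).
- exact: simple_self (reach_refl j).
- exact: simple_self njk.
split=> [A B PA QB|X].
  split=> f; apply: contrapT => /(common_constituent ssM basisS)[l []].
    by move=> /PA jl /QB.
  by move=> /QB njl /PA.
have [I [l dX]] := simple_decomposition ssM basisS X.
pose p i := `[< reach j (l i) >].
have [[[addM _ _ _ _] _] _ _] := ssM.
have [A dA] := addM _ (fun i : {i | p i} => S (l (val i))).
have [B dB] := addM _ (fun i : {i | ~~ p i} => S (l (val i))).
exists A, B; split; last exact: dsum_split dX dA dB.
- move=> a; rewrite (mult_dsum ssM basisS a dA) => /eqP; rewrite -lt0n.
  by case/card_gt0P => i; rewrite inE => /eqP <-; exact/asboolP/(valP i).
- move=> a; rewrite (mult_dsum ssM basisS a dB) => /eqP; rewrite -lt0n.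
  case/card_gt0P => i; rewrite inE => /eqP <- ja.
  by move: (valP i) => /negP; apply; exact/asboolP.
Qed.

End Connected.

(** * Positive matrices *)

Section Perron.
Variables (R : realType) (n : nat) (T : 'M[R]_n.+1).
Implicit Types x y : 'I_n.+1 -> R.

Let app x i := \sum_j T i j * x j.

Section Collatz.
Hypothesis T_ge0 : forall i j, 0 <= T i j.

(* If a x i <= (T x) i with x >= 0 of sum 1, then adding over i shows that a is
   at most the sum of the entries of T; the 1 makes B also bound the x i. *)
Let B : R := 1 + \sum_i \sum_j T i j.

Let B_ge1 : 1 <= B.
Proof. by rewrite lerDl; do 2![apply: sumr_ge0 => ? _]. Qed.

(* Coordinate 0 is the candidate eigenvalue, the others are those of the
   vector. *)
Let sub_pairs : set 'rV[R]_n.+2 :=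
  ([set v : 'rV[R]_n.+2 | forall i, `[0, B]%classic (v ord0 i)] `&`
   ([set v | 1 <= \sum_i v ord0 (lift ord0 i)] `&`
    \bigcap_i [set v | 0 <= app (fun j => v ord0 (lift ord0 j)) i -
                          v ord0 ord0 * v ord0 (lift ord0 i)]))%classic.

Let compact_sub_pairs : compact sub_pairs.
Proof.
have box_compact : compact
    [set v : 'rV[R]_n.+2 | forall i, `[0, B]%classic (v ord0 i)].
  by apply: (@rV_compact R _ (fun=> `[0, B]%classic)) => _; exact: segment_compact.
apply: (subclosed_compact _ box_compact) => [|v []//].
apply: closedI; first by apply: compact_closed => //; exact: norm_hausdorff.
have cc i : continuous (fun v : 'rV[R]_n.+2 => v ord0 i) := @coord_continuous _ _ _ _ _.
have closed_cond (f : 'rV[R]_n.+2 -> R) b : continuous f ->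
    closed [set v | b <= f v]%classic.
  by move=> /continuous_closedP/(_ _ (@closed_ge _ b)).
apply: closedI.
  by apply/closed_cond/continuous_big => [|i _]; [exact: add_continuous|exact: cc].
apply: closed_bigI => i _; apply: closed_cond.
have capp : continuous (fun v : 'rV[R]_n.+2 => app (fun j => v ord0 (lift ord0 j)) i).
  apply: continuous_big => [|j _ v]; first exact: add_continuous.
  exact: cvgM (cvg_cst (T i j)) (cc (lift ord0 j) v).
by move=> v; exact: cvgB (capp v) (cvgM (cc ord0 v) (cc (lift ord0 i) v)).
Qed.

Let in_sub_pairs x a :
  (forall i, 0 <= x i) -> \sum_i x i = 1 -> 0 <= a ->
  (forall i, a * x i <= app x i) ->
  sub_pairs (\row_i if unlift ord0 i is Some j then x j else a).
Proof.
move=> x_ge0 sx a_ge0 ax; set v := \row_i _.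
have v0 : v ord0 ord0 = a by rewrite mxE unlift_none.
have vS i : v ord0 (lift ord0 i) = x i by rewrite mxE liftK.
have x_le1 i : x i <= 1.
  by rewrite -sx (bigD1 i) //= lerDl sumr_ge0.
have a_le : a <= B.
  rewrite -[a]mulr1 -sx mulr_sumr (le_trans (ler_sum _ (fun i _ => ax i))) //.
  rewrite /B ler_wpDl //; apply: ler_sum => i _; apply: ler_sum => j _.
  by rewrite ler_piMr.
split; [|split].
- move=> i /=; rewrite in_itv /=; case: (unliftP ord0 i) => [j|] ->.
    by rewrite vS x_ge0 (le_trans (x_le1 j)).
  by rewrite v0 a_ge0.
- by rewrite /= (eq_bigr x) ?sx // => i _; rewrite vS.
- move=> i _ /=; rewrite v0 vS subr_ge0 (le_trans (ax i)) //.
  by apply: ler_sum => j _; rewrite vS.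
Qed.

(** The largest a admitting a nonzero x >= 0 with a x <= T x exists because,
    with x normalized, such pairs form a compact set. *)
Lemma collatz_wielandt :
  exists x r, [/\ forall i, 0 <= x i, exists i, 0 < x i,
    forall i, r * x i <= app x i
  & forall y a, (forall i, 0 < y i) -> 0 <= a ->
      (forall i, a * y i <= app y i) -> a <= r].
Proof.
have app_scale c x i : app (fun j => c * x j) i = c * app x i.
  by rewrite mulr_sumr; apply: eq_bigr => j _; rewrite mulrCA.
have normalize y : (forall i, 0 < y i) -> exists c, 0 < c /\ \sum_i c * y i = 1.
  move=> y0; have sy : 0 < \sum_i y i.
    by rewrite big_ord_recl ltr_pwDl // sumr_ge0 // => i _; exact: ltW.
  by exists (\sum_i y i)^-1; rewrite invr_gt0 -mulr_sumr mulVf ?gt_eqF.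
have mem y a : (forall i, 0 < y i) -> 0 <= a ->
    (forall i, a * y i <= app y i) -> exists2 v, sub_pairs v & v ord0 ord0 = a.
  move=> y0 a0 ay; have [c [c0 cy]] := normalize y y0.
  exists (\row_i if unlift ord0 i is Some j then c * y j else a).
    apply: in_sub_pairs => // i; first by rewrite ltW ?mulr_gt0.
    by rewrite app_scale mulrCA ler_pM2l.
  by rewrite mxE unlift_none.
have [||v vA maxv] := compact_EVT_max (f := fun v : 'rV_n.+2 => v ord0 ord0) _
    compact_sub_pairs.
- have [i|v vA _] := mem (fun=> 1) 0 (fun=> ltr01) (lexx 0); last by exists v.
  by rewrite mul0r sumr_ge0 // => j _; rewrite mulr1.
- by apply: continuous_subspaceT => v; exact: coord_continuous.
move: vA; rewrite inE => -[box [/= sum1 ineq]].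
exists (fun i => v ord0 (lift ord0 i)), (v ord0 ord0); split.
- by move=> i; have /= := box (lift ord0 i); rewrite in_itv => /andP[].
- apply: contrapT => no_i; have : 1 <= 0 :> R.
    rewrite (le_trans sum1) // sumr_le0 // => i _; rewrite leNgt.
    by apply/negP => h; apply: no_i; exists i.
  by rewrite leNgt ltr01.
- by move=> i; have /= := ineq i Logic.I; rewrite subr_ge0.
- move=> y a y0 a0 ay; have [w wA <-] := mem y a y0 a0 ay.
  by apply: maxv; rewrite inE.
Qed.
End Collatz.

Hypothesis T_gt0 : forall i j, 0 < T i j.

Lemma positive_app x i :
  (forall j, 0 <= x j) -> (exists j, 0 < x j) -> 0 < app x i.
Proof.
move=> x0 [j xj]; rewrite /app (bigD1 j) //= ltr_pwDl ?mulr_gt0 //.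
by rewrite sumr_ge0 // => k _; rewrite mulr_ge0 // ltW.
Qed.

Lemma exists_min x : exists k, forall i, x k <= x i.
Proof.
by case: (arg_minP x (i0 := ord0) (P := xpredT)) => // k _ mk;
  exists k => i; exact: mk.
Qed.

(** If x attains the maximal ratio r, then T x = r x: otherwise T (T x) > r T x
    in every coordinate, and T x would have a larger ratio. *)
Theorem perron :
  exists d r, [/\ forall i, 0 < d i, 0 < r & forall i, app d i = r * d i].
Proof.
have [|x [r [x0 xn0 rx maxr]]] := collatz_wielandt.
  by move=> i j; exact: ltW.
have Tx0 i : 0 < app x i by exact: positive_app.
have appB c y z i : app (fun j => y j - c * z j) i = app y i - c * app z i.
  rewrite mulr_sumr -sumrB; apply: eq_bigr => j _.
  by rewrite mulrBr [in LHS]mulrCA.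
have eqx i : app x i = r * x i.
  apply: contrapT => /eqP neq.
  have gt j : r * app x j < app (app x) j.
    rewrite -subr_gt0 -appB; apply: positive_app; first by move=> k; rewrite subr_ge0.
    by exists i; rewrite subr_gt0 lt_neqAle eq_sym neq rx.
  have [k mk] := exists_min (fun j => app (app x) j / app x j).
  have : app (app x) k / app x k <= r.
    apply: (maxr (app x)) => // [|j]; last by rewrite -ler_pdivlMr.
    by rewrite divr_ge0 ?ltW // positive_app // => [j|]; [exact: ltW|exists k].
  by rewrite ler_pdivrMr // leNgt gt.
have [i xi] := xn0; have r0 : 0 < r.
  by rewrite -(pmulr_lgt0 _ xi) -eqx.
by exists x, r; split=> // j; rewrite -(pmulr_rgt0 _ r0) -eqx.
Qed.

(** Subtract from w the largest multiple of d that stays below it: the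
    difference is a nonnegative eigenvector with a zero coordinate. *)
Lemma perron_unique d r w :
  (forall i, 0 < d i) -> (forall i, app d i = r * d i) ->
  (forall i, app w i = r * w i) -> exists c, forall i, w i = c * d i.
Proof.
move=> d0 dE wE; have [k mk] := exists_min (fun i => w i / d i).
pose z i := w i - w k / d k * d i.
have z0 i : 0 <= z i by rewrite subr_ge0 -ler_pdivlMr.
have zk : z k = 0 by rewrite /z divfK ?subrr ?gt_eqF.
have zE i : app z i = r * z i.
  rewrite /z mulrBr -wE mulrCA -dE mulr_sumr -sumrB.
  by apply: eq_bigr => j _; rewrite mulrBr [in LHS]mulrCA.
exists (w k / d k) => i; apply/eqP; rewrite -subr_eq0 eq_le z0 andbT leNgt.
apply/negP => zi; have : 0 < app z k by apply: positive_app => //; exists i.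
by rewrite zE zk mulr0 ltxx.
Qed.

End Perron.

(** If u N = a u with a > 0, then a |u| <= |u| N entrywise; pairing with v
    gives a <= r. That r is an eigenvalue for row vectors too is a matter of
    determinants. *)
Lemma positive_eigenvector_largest (R : realType) n (N : 'M[R]_n) (v : 'I_n -> R)
    (r : R) :
  (0 < n)%N -> (forall i j, 0 <= N i j) -> (forall i, 0 < v i) -> 0 < r ->
  (forall i, \sum_j N i j * v j = r * v i) -> largest_pos_eigenvalue N r.
Proof.
move=> n0 N0 v0 r0 vE; split=> // [|a /eigenvalueP[u uE un0] a0].
  pose c : 'cV[R]_n := \col_i v i.
  have : \det (r%:M - N)^T == 0.
    apply/det0P; exists c^T.
      apply/eqP => /rowP/(_ (Ordinal n0)); rewrite !mxE => E.
      by have := v0 (Ordinal n0); rewrite E ltxx.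
    rewrite -trmx_mul mulmxBl mul_scalar_mx; apply/rowP => i; rewrite !mxE.
    by under eq_bigr do rewrite mxE; rewrite vE subrr.
  rewrite det_tr => /det0P[u un0 uE]; apply/eigenvalueP; exists u => //.
  by apply/esym/eqP; rewrite -subr_eq0 -mul_mx_scalar -mulmxBr uE.
have [k uk] : exists k, u 0 k != 0 by exact/rV0Pn.
have pos : 0 < \sum_j `|u 0 j| * v j.
  rewrite (bigD1 k) //= ltr_pwDl ?mulr_gt0 ?normr_gt0 //.
  by rewrite sumr_ge0 // => j _; rewrite mulr_ge0 // ltW.
rewrite -(ler_pM2r pos).
have -> : r * \sum_j `|u 0 j| * v j = \sum_j (\sum_i `|u 0 i| * N i j) * v j.
  rewrite mulr_sumr; under [RHS]eq_bigr do rewrite mulr_suml.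
  rewrite exchange_big; apply: eq_bigr => i _ /=.
  by rewrite mulrCA -vE mulr_sumr; apply: eq_bigr => j _; rewrite mulrA.
rewrite mulr_sumr; apply: ler_sum => j _; rewrite mulrA ler_wpM2r ?(ltW (v0 j)) //.
have -> : a * `|u 0 j| = `|(u *m N) 0 j|.
  by rewrite uE mxE normrM (gtr0_norm a0).
rewrite mxE (le_trans (ler_norm_sum _ _ _)) //; apply: ler_sum => i _.
by rewrite normrM (ger0_norm (N0 i j)).
Qed.

Lemma largest_pos_eigenvalue_uniq (R : realType) n (N : 'M[R]_n) (a b : R) :
  largest_pos_eigenvalue N a -> largest_pos_eigenvalue N b -> a = b.
Proof.
move=> [ea a0 ma] [eb b0 mb]; apply: le_anti.
by rewrite (ma b) // (mb a).
Qed.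

(** * Integrality *)

(** If t = p / q in lowest terms and every t ^+ k * c is an integer, then
    q ^ k divides c for every k, so q = 1. *)
Lemma bounded_denominator (R : realFieldType) (t : R) (c : nat) (m : nat -> nat) :
  (0 < c)%N -> (forall k, t ^+ k * c%:R = (m k)%:R) -> exists p : nat, t = p%:R.
Proof.
move=> c0 tE; pose g := gcdn (m 1%N) c.
have g0 : (0 < g)%N by rewrite gcdn_gt0 c0 orbT.
pose p := (m 1 %/ g)%N; pose q := (c %/ g)%N.
have mE : m 1%N = (p * g)%N by rewrite divnK ?dvdn_gcdl.
have cE : c = (q * g)%N by rewrite divnK ?dvdn_gcdr.
have pq : coprime p q.
  by rewrite /coprime -(eqn_pmul2r g0) muln_gcdl -mE -cE mul1n.
have q0 : (0 < q)%N by move: c0; rewrite cE muln_gt0 => /andP[].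
have tq : t * q%:R = p%:R.
  apply: (mulIf (x := g%:R)); first by rewrite pnatr_eq0 -lt0n.
  by rewrite -mulrA -!natrM -mE -cE -tE expr1.
have qdvd k : (q ^ k %| c)%N.
  rewrite -(@Gauss_dvdr _ (p ^ k)) ?coprimeXl ?coprimeXr // 1?coprime_sym //.
  apply/dvdnP; exists (m k); apply/eqP; rewrite -(eqr_nat R) !natrM !natrX -tE.
  by rewrite -tq exprMn mulrAC.
have q1 : q = 1%N.
  apply/eqP; rewrite eqn_leq q0 andbT leqNgt; apply/negP => q_gt1.
  by have := dvdn_leq c0 (qdvd c); rewrite leqNgt ltn_expl.
by exists p; rewrite -tq q1 mulr1.
Qed.

(** All A ^ k e = t ^ k e are integer vectors, so the powers of t have a common
    denominator. *)
Lemma integer_eigenvalue (R : realFieldType) n (A : 'I_n -> 'I_n -> nat)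
    (e : 'I_n -> nat) (t : R) (i0 : 'I_n) :
  (0 < e i0)%N -> (forall i, \sum_j (A i j)%:R * (e j)%:R = t * (e i)%:R) ->
  exists p : nat, t = p%:R.
Proof.
move=> e0 eE.
have [|m mE] := choice (P := fun k (f : 'I_n -> nat) =>
    forall i, t ^+ k * (e i)%:R = (f i)%:R).
  elim=> [|k [f fE]]; first by exists e => i; rewrite mul1r.
  exists (fun i => \sum_j A i j * f j)%N => i.
  rewrite exprSr -mulrA -eE natr_sum mulr_sumr; apply: eq_bigr => j _.
  by rewrite mulrCA fE natrM.
exact: (bounded_denominator e0 (fun k => mE k i0)).
Qed.

(** The singular matrix z - T has a rational kernel vector, and the real kernel
    is the line of d; so the ratios of the d i are rational, and a common
    denominator clears them. *)
Lemma integer_perron_vector (R : realType) n (T : 'I_n.+1 -> 'I_n.+1 -> nat)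
    (d : 'I_n.+1 -> R) (z : int) :
  (forall i j, (0 < T i j)%N) -> (forall i, 0 < d i) ->
  (forall i, \sum_j (T i j)%:R * d j = z%:~R * d i) ->
  exists e : 'I_n.+1 -> nat, (forall i, (0 < e i)%N) /\
    exists c : R, forall i, (e i)%:R = c * d i.
Proof.
move=> T0 d0 dE.
(* The field is a parameter so that determinants over rat and over R can be
   compared. *)
pose N (F : fieldType) : 'M[F]_n.+1 := \matrix_(i, j) (T i j)%:R.
pose A (F : fieldType) : 'M[F]_n.+1 := z%:~R%:M - N F.
have AE : A R = map_mx ratr (A rat).
  by apply/matrixP => i j; rewrite !mxE rmorphB /= ratr_nat rmorphMn /= ratr_int.
have mulA (F : fieldType) (x : 'rV[F]_n.+1) i : (x *m (A F)^T) 0 i =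
    z%:~R * x 0 i - \sum_j (T i j)%:R * x 0 j.
  rewrite linearB /= tr_scalar_mx mulmxBr mul_mx_scalar !mxE; congr (_ - _).
  by apply: eq_bigr => j _; rewrite !mxE mulrC.
have : \det (A rat)^T == 0.
  rewrite det_tr -(fmorph_eq0 (ratr : {rmorphism rat -> R})) -det_map_mx -AE.
  rewrite -det_tr; apply/det0P; exists (\row_i d i).
    apply/eqP => /rowP/(_ ord0); rewrite !mxE => E.
    by have := d0 ord0; rewrite E ltxx.
  apply/rowP => i; rewrite mulA !mxE -dE; apply/eqP; rewrite subr_eq0.
  by apply/eqP/eq_bigr => j _; rewrite mxE.
move=> /det0P[w wn0 wE].
have [c cE] : exists c, forall i, ratr (w 0 i) = c * d i.
  apply: (perron_unique (T := N R) (r := z%:~R) _ d0) => [i j|i|i]; first by rewrite mxE ltr0n.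
    by rewrite -dE; apply: eq_bigr => j _; rewrite mxE.
  have /rowP/(_ i)/eqP := wE; rewrite mulA mxE subr_eq0 => /eqP/(congr1 (ratr : rat -> R)).
  rewrite rmorphM /= ratr_int => ->; rewrite rmorph_sum /=.
  by apply: eq_bigr => j _; rewrite mxE rmorphM /= ratr_nat.
have cn0 : c != 0.
  apply: contraNneq wn0 => c0; apply/eqP/rowP => i; rewrite mxE.
  by apply: (fmorph_inj (ratr : {rmorphism rat -> R})); rewrite /= cE c0 mul0r rmorph0.
pose q i := w 0 i / w 0 ord0.
have qE i : ratr (q i) = d i / d ord0.
  by rewrite rmorphM fmorphV /= !cE invfM mulrACA divff ?mul1r.
have q0 i : 0 < q i by rewrite -(ltr0q R) qE divr_gt0.
have numE i : q i * `|denq (q i)|%N%:R = `|numq (q i)|%N%:R.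
  rewrite !pmulrn !abszE ger0_norm ?(ltW (denq_gt0 _)) // ger0_norm -?numqE //.
  by rewrite numq_ge0 ltW.
pose D := (\prod_j `|denq (q j)|)%N.
exists (fun i => `|numq (q i)| * \prod_(j | j != i) `|denq (q j)|)%N; split.
  move=> i; rewrite muln_gt0 absz_gt0 numq_eq0 gt_eqF //=.
  by apply: prodn_gt0 => j; rewrite absz_gt0 denq_neq0.
exists (D%:R / d ord0) => i; rewrite mulrAC -mulrA -qE.
have -> : D = (`|denq (q i)| * \prod_(j | j != i) `|denq (q j)|)%N.
  by rewrite /D (bigD1 i).
rewrite !natrM -(ratr_nat R `|numq _|) -numE rmorphM /= ratr_nat.
by rewrite [RHS]mulrC mulrA.
Qed.

(** * Weights and Frobenius-Perron dimensions *)

Section Weight.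
Variables (R : realType) (K : fieldType) (C : linCat K) (n : nat) (S : 'I_n -> C).
Variable d : 'I_n -> R.
Hypotheses (ssC : finite_semisimple_cat C) (basisS : simple_basis S).
Hypothesis d_gt0 : forall k, 0 < d k.

Definition weight (A : C) : R := \sum_k d k *+ mult S k A.

Lemma weight_additive : additive_fun weight.
Proof.
move=> I F A dA; rewrite [RHS]exchange_big; apply: eq_bigr => k _ /=.
by rewrite (mult_additive ssC basisS k dA) -sumrMnr.
Qed.

Lemma weight_simple k : weight (S k) = d k.
Proof.
rewrite /weight (bigD1 k) //= big1 ?addr0 => [|l lk];
  rewrite (mult_simple ssC basisS) ?eqxx //.
by rewrite eq_sym (negPf lk).
Qed.

Lemma weight_gt0 A : ~ is_zero A -> 0 < weight A.
Proof.
move=> /(exists_mult ssC basisS)[k /eqP k0].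
rewrite /weight (bigD1 k) //= ltr_pwDl ?pmulrn_lgt0 ?lt0n //.
by apply: sumr_ge0 => l _; rewrite mulrn_wge0 // ltW.
Qed.

End Weight.

(** The values of v on the simple objects form a positive eigenvector of the
    matrix of X, so r is its largest eigenvalue. This is how both the dimension
    in C and the one in the dual category are recognized. *)
Lemma mult_matrix_eigenvalue (R : realType) (C : tensorCat R[i]) (X : C) n
    (S : 'I_n -> C) (N : 'M[nat]_n) (v : C -> R) (r : R) :
  mult_matrix X S N -> (0 < n)%N -> additive_fun v -> (forall i, 0 < v (S i)) ->
  0 < r -> (forall i, v (X \ox S i) = r * v (S i)) ->
  largest_pos_eigenvalue (map_mx (fun m : nat => m%:R) N) r.
Proof.
move=> multX n0 v_add v0 r0 vE.
apply: (@positive_eigenvector_largest _ _ _ (fun i => v (S i))) => // [i j|i].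
  by rewrite mxE ler0n.
rewrite -vE (v_add _ _ _ (multX i)).
rewrite -(sig_big_dep xpredT (fun=> xpredT) (fun j (_ : 'I_(N i j)) => v (S j))) /=.
by apply: eq_bigr => j _; rewrite sumr_const card_ord mxE mulr_natl.
Qed.

Section DualCategory.
Variables (K : fieldType) (C : tensorCat K) (M : moduleCat C).

Lemma functor_dsum (F : modFunctor M) (I : finType) (B : I -> M) A :
  is_dsum B A -> is_dsum (fun i => F (B i)) (F A).
Proof.
apply: (dsum_functor (fm := fun A B (f : hom A B) => fmap F f)).
- exact: fmap_lin.
- exact: fmap_id.
- by move=> *; exact: fmap_comp.
Qed.

Lemma eval_dsum (A : M) (I : finType) (G : I -> dual_cat M) (F : dual_cat M) :
  is_dsum G F -> is_dsum (fun i => (G i : modFunctor M) A) ((F : modFunctor M) A).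
Proof.
apply: (dsum_functor (C := dual_cat M) (fo := fun F : dual_cat M => (F : modFunctor M) A)
  (fm := fun F G (s : modTrans F G) => s A)) => //.
Qed.

Lemma zero_functor (F : dual_cat M) :
  (forall A, is_zero ((F : modFunctor M) A)) -> is_zero F.
Proof. by move=> F0; apply: modTransP => A; exact: F0. Qed.

End DualCategory.

Section DualCharacter.
Variables (R : realType) (C : tensorCat R[i]) (M : moduleCat C).
Hypotheses (fusC : is_fusion C) (intC : integer_FPdims C).
Hypotheses (ssM : finite_semisimple_cat M) (indM : indecomposable M).

Let rigC : rigid_cat C. Proof. by case: fusC. Qed.
Let ssC : finite_semisimple_cat C. Proof. by case: fusC. Qed.

(** If S k occurs in Z . S j, then it occurs in Y . S j for a simple constituent
    Y of Z, so the sum of all simple objects of C has a positive matrix. *)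
Lemma exists_regular m (S : 'I_m -> M) : simple_basis S ->
  exists X : C, ~ is_zero X /\ forall j k, (0 < mult S k (X \act S j))%N.
Proof.
move=> basisS; have [_ [n [Y basisY]] _] := ssC.
have [[[addC _ _ _ _] _] _ _] := ssC; have [X dX] := addC _ Y.
have posX j k : (0 < mult S k (X \act S j))%N.
  have [Z] := indecomposable_reach rigC ssM basisS indM j k.
  have add_l : additive_fun (fun Z : C => mult S k (Z \act S j)).
    by move=> I F W /(act_dsuml (S j))/(mult_additive ssM basisS k).
  rewrite (additive_expand ssC basisY Z add_l) (add_l _ _ _ dX) => s0.
  rewrite lt0n; apply/eqP => sum0; apply: s0; rewrite big1 // => i _.
  move/eqP: sum0; rewrite (bigD1 i) //= addn_eq0 => /andP[/eqP -> _].
  exact: mul0rn.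
exists X; split=> // X0; have [[A A0] _] := indM.
have [j _] := exists_mult ssM basisS A0; have := posX j j.
rewrite (additive_zero (mult_additive ssM basisS j)) //.
by rewrite /is_zero -actm_id X0 (lin0 (actm_linl _)).
Qed.

(** The Perron eigenvalue is the dimension of X because Z -> weight (Z . A), for
    a nonzero A, is a positive eigenvector of multiplication by X in the
    Grothendieck ring of C. *)
Lemma perron_weight :
  exists m (S : 'I_m.+1 -> M) (X : C) (d : 'I_m.+1 -> R) (z : int),
  [/\ simple_basis S, forall j k, (0 < mult S k (X \act S j))%N,
      forall k, 0 < d k
    & forall A, weight S d (X \act A) = z%:~R * weight S d A].
Proof.
have [_ [[|m] [S basisS]] _] := ssM.
  by have [[A /(exists_mult ssM basisS)[[]]]] := indM.
have [X [X0 posX]] := exists_regular basisS.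
have [|d [r [d0 r0 dE]]] := @perron R m (\matrix_(j, k) (mult S k (X \act S j))%:R).
  by move=> j k; rewrite mxE ltr0n.
have {}dE j : \sum_k (mult S k (X \act S j))%:R * d k = r * d j.
  by rewrite -dE; apply: eq_bigr => k _; rewrite mxE.
have w_add := weight_additive d ssM basisS.
have wX A : weight S d (X \act A) = r * weight S d A.
  have wX_add : additive_fun (fun A => weight S d (X \act A)).
    by move=> I F B /(act_dsumr X)/w_add.
  rewrite (additive_expand ssM basisS A wX_add) mulr_sumr; apply: eq_bigr => j _.
  rewrite mulrnAr -dE; congr (_ *+ _); apply: eq_bigr => k _.
  by rewrite mulr_natl.
suff [z rz] : exists z : int, r = z%:~R.
  by exists m, S, X, d, z; split=> // A; rewrite wX rz.
have [z [[/X0//]|[n [Y [N [basisY multX eigX]]]]]] := intC X.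
exists z; apply: largest_pos_eigenvalue_uniq eigX.
have S0 : ~ is_zero (S ord0) by case: basisS => sS _ _; exact: (sS _).1.
apply: (mult_matrix_eigenvalue (v := fun Z => weight S d (Z \act S ord0)) multX) => //.
- by have [i _] := exists_mult ssC basisY X0; exact: leq_ltn_trans (ltn_ord i).
- by move=> I F Z /(act_dsuml (S ord0))/w_add.
- move=> i; apply: (weight_gt0 ssM basisS d0); apply: act_neq0 => //.
  by case: basisY => sY _ _; exact: (sY i).1.
- by move=> i; rewrite (additive_iso w_add (act_assoc X (Y i) (S ord0))).
Qed.

(** F commutes with X, so weight (F _) is again an eigenvector of X for the
    Perron eigenvalue, hence a multiple of weight. The factor is an eigenvalue
    of the matrix of F, which has natural entries and an integer
    eigenvector. *)
Lemma integer_character : exists (A : M) (w : M -> R),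
  [/\ additive_fun w, forall B, ~ is_zero B -> 0 < w B, ~ is_zero A
   & forall F : modFunctor M, exists p : nat, forall B, w (F B) = p%:R * w B].
Proof.
have [m [S [X [d [z [basisS posX d0 wX]]]]]] := perron_weight.
have w_add := weight_additive d ssM basisS.
have dE j : \sum_k (mult S k (X \act S j))%:R * d k = z%:~R * d j.
  rewrite -(weight_simple d ssM basisS) -wX; apply: eq_bigr => k _.
  exact: mulr_natl.
have [e [e0 [c eE]]] := integer_perron_vector posX d0 dE.
exists (S ord0), (weight S d); split=> //.
- exact: weight_gt0.
- by case: basisS => sS _ _; exact: (sS _).1.
move=> F; have wF_add : additive_fun (fun B => weight S d (F B)).
  by move=> I G B /(functor_dsum F)/w_add.
have [t tE] : exists t, forall k, weight S d (F (S k)) = t * d k.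
  apply: (perron_unique (T := \matrix_(j, k) (mult S k (X \act S j))%:R)
    (r := z%:~R) _ d0) => [j k|j|j]; first by rewrite mxE ltr0n.
    by rewrite -dE; apply: eq_bigr => k _; rewrite mxE.
  rewrite -wX -(additive_iso w_add (_ : iso (F (X \act S j)) _)); last first.
    by exists (fstr F X (S j)); exact: fstr_iso.
  rewrite (additive_expand ssM basisS _ wF_add); apply: eq_bigr => k _.
  by rewrite mxE mulr_natl.
have [p tp] : exists p : nat, t = p%:R.
  apply: (integer_eigenvalue (A := fun k l => mult S l (F (S k))) (e0 ord0)) => k.
  rewrite eE mulrCA -tE mulr_sumr; apply: eq_bigr => l _.
  by rewrite eE mulrCA mulr_natl.
exists p => B; rewrite (additive_expand ssM basisS B wF_add) mulr_sumr.
by apply: eq_bigr => k _; rewrite tE tp mulrnAr.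
Qed.

End DualCharacter.

Theorem theorem8p35 (R : realType) (C : tensorCat R[i])
    (hC : is_fusion C) (hint : integer_FPdims C)
    (M : moduleCat C) (hM : finite_semisimple_cat M) (hind : indecomposable M)
    (hD : is_fusion (dual_cat M)) :
  integer_FPdims (dual_cat M).
Proof.
have [A [w [w_add w_gt0 A0 scalar]]] := integer_character hC hint hM hind.
have zeroP (F : dual_cat M) :
    (forall B, w ((F : modFunctor M) B) = 0 * w B) -> is_zero F.
  move=> wF; apply: zero_functor => B; apply: contrapT => /w_gt0.
  by rewrite wF mul0r ltxx.
have [ssD _ _] := hD; have [_ [n [G basisG]] _] := ssD.
move=> F; have [p wF] := scalar F; exists p; have [p0|p_gt0] := posnP p.
  left; split; last by rewrite p0.
  by apply: zeroP => B; rewrite wF p0.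
have wA := w_gt0 _ A0.
have F0 : ~ is_zero F.
  move=> F0; have := mulr_gt0 (_ : 0 < p%:R) wA; rewrite ltr0n -wF => /(_ p_gt0).
  have /(additive_zero w_add) -> : is_zero ((F : modFunctor M) A).
    exact: (congr1 (fun s : modTrans F F => s A) F0).
  by rewrite ltxx.
(* w (H A) is additive in H, and w (F (H A)) = p * w (H A): evaluation at A
   turns the character into the eigenvector required. *)
right; pose N : 'M[nat]_n := \matrix_(i, j) mult G j (F \ox G i).
have multF : mult_matrix F G N.
  by move=> i; apply: (mult_decomposition ssD basisG) => j; rewrite mxE.
exists n, G, N; split=> //.
apply: (mult_matrix_eigenvalue (v := fun H : dual_cat M => w ((H : modFunctor M) A))
  multF) => //.
- by have [i _] := exists_mult ssD basisG F0; exact: leq_ltn_trans (ltn_ord i).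
- by move=> I H H' /(eval_dsum A)/w_add.
- move=> i; have [q wG] := scalar (G i); rewrite wG mulr_gt0 // ltr0n lt0n.
  apply/eqP => q0; case: basisG => /(_ i) [] + _ _ _; apply.
  by apply: zeroP => B; rewrite wG q0.
- by rewrite ltr0n.
- by move=> i; exact: wF.
Qed.
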